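(* Let $(G_{j,j'})_{1\le j,j'\le d}$ be a matrix valued spectral measure on the torus $[-\pi,\pi)^\nu$, and let $(Z_{G,1},\dots,Z_{G,d})$ be a vector valued random spectral measure corresponding to it. Define the $d$-dimensional vector valued Gaussian stationary field $(X_1(p),\dots,X_d(p))$, $p\in\mathbb{Z}^\nu$, by $X_j(p)=\int_{[-\pi,\pi)^\nu}e^{i(p,x)}Z_{G,j}(dx)$, $1\le j\le d$. For $1\le j\le d$ define the set of complex valued functions on the torus $$\mathcal{K}_{1,j}=\left\{u:\int|u(x)|^2G_{j,j}(dx)<\infty,\quad u(-x)=\overline{u(x)}\ \text{for all }x\in[-\pi,\pi)^\nu\right\}.$$ Then $\mathcal{K}_{1,j}$ is a real Hilbert space with the scalar product $\langle u,v\rangle=\int u(x)\overline{v(x)}G_{j,j}(dx)$, $u,v\in\mathcal{K}_{1,j}$. Let $\mathcal{H}_{1,j}$ be the real Hilbert space which is the closure of the set of finite linear combinations $\sum_{k=1}^Nc_kX_j(p_k)$, $p_k\in\mathbb{Z}^\nu$, with real coefficients $c_k$, in the Hilbert space $\mathcal{H}$ of random variables with finite second moments (with the usual scalar product) on the probability space where the random spectral measures $Z_{G,j}$ are defined. Then the map $T_j(u)=\int u(x)Z_{G,j}(dx)$, $u\in\mathcal{K}_{1,j}$, is a norm preserving, invertible linear transformation from the real Hilbert space $\mathcal{K}_{1,j}$ to the real Hilbert space $\mathcal{H}_{1,j}$.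
   Context: The torus $[-\pi,\pi)^\nu$ is obtained by identifying coordinates modulo $2\pi$; sets are Borel measurable; $-A=\{-x:x\in A\}$. Functions equal $G_{j,j}$-almost everywhere are identified in $\mathcal{K}_{1,j}$. Matrix valued spectral measure on the torus: complex measures $G_{j,j'}$, $1\le j,j'\le d$, of finite total variation such that for some finite positive measure $\mu$ all $G_{j,j'}$ are absolutely continuous with respect to $\mu$, the matrix $(\frac{dG_{j,j'}}{d\mu}(x))$ is positive semidefinite for $\mu$-almost all $x$, and $G_{j,j'}(-A)=\overline{G_{j,j'}(A)}$ for all $A$ and $j,j'$. Vector valued random spectral measure corresponding to $G$: complex valued random variables $Z_{G,j}(A)$, $1\le j\le d$, $A\subset[-\pi,\pi)^\nu$ Borel, such that (i) the real and imaginary parts of any finitely many of them are jointly Gaussian; (ii) $EZ_{G,j}(A)=0$; (iii) $EZ_{G,j}(A)\overline{Z_{G,j'}(B)}=G_{j,j'}(A\cap B)$; (iv) $\sum_{s=1}^nZ_{G,j}(A_s)=Z_{G,j}(\bigcup_{s=1}^nA_s)$ for disjoint $A_1,\dots,A_n$; (v) $Z_{G,j}(A)=\overline{Z_{G,j}(-A)}$. Random integral: for $u=\sum_{s=1}^Nc_s\mathbf{1}_{A_s}$ ($A_s$ disjoint, $c_s\in\mathbb{C}$), $\int u(x)Z_{G,j}(dx)=\sum_{s=1}^Nc_sZ_{G,j}(A_s)$; for general complex valued $u$ with $\int|u|^2dG_{j,j}<\infty$ the integral is defined by the unique continuous extension from $L_2(G_{j,j})$ to the complex $L_2$ space of random variables.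 *)

(* Defs.v *)
From HB Require Import structures.
From mathcomp Require Import all_boot all_order all_algebra.
From mathcomp Require Import generic_quotient ring_quotient complex.
From mathcomp Require Import all_classical all_reals all_analysis.
From mathcomp Require Import measurable_realfun.
Import Order.TTheory GRing.Theory Num.Theory.
Import numFieldNormedType.Exports.
Import Normc Quotient.

Set Implicit Arguments.
Unset Strict Implicit.
Unset Printing Implicit Defensive.

Local Open Scope classical_set_scope.
Local Open Scope ring_scope.
Local Open Scope complex_scope.
Local Open Scope quotient_scope.

Definition cmeasurable d (T : measurableType d) (R : realType)
    (f : T -> R[i]) : Prop :=
  measurable_fun [set: T] (fun x => complex.Re (f x)) /\
  measurable_fun [set: T] (fun x => complex.Im (f x)).

Definition cintegral d (T : measurableType d) (R : realType)
    (mu : {measure set T -> \bar R}) (f : T -> R[i]) : R[i] :=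
  Rintegral mu [set: T] (fun x => complex.Re (f x)) +i*
  Rintegral mu [set: T] (fun x => complex.Im (f x)).

Definition sq_integrable d (T : measurableType d) (R : realType)
    (mu : {measure set T -> \bar R}) (f : T -> R[i]) : Prop :=
  cmeasurable f /\ (\int[mu]_x (normc (f x) ^+ 2)%:E < +oo)%E.

Section L2.
Context d (T : measurableType d) (R : realType).
Variable mu : {measure set T -> \bar R}.

(* [Rcomplex R] is [R[i]] with its structure of a real vector space; all the
   linear structure below is over the reals. *)
Definition sq_integrable_pred : {pred T -> Rcomplex R} :=
  mem [set f : T -> Rcomplex R | sq_integrable mu f].

Lemma measurable_normc (f : T -> R[i]) : cmeasurable f ->
  measurable_fun [set: T] (fun x => normc (f x)).
Proof.
case=> mr mi.
rewrite (_ : (fun x => _) =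
  (fun x => Num.sqrt (complex.Re (f x) ^+ 2 + complex.Im (f x) ^+ 2)));
  last first.
  by apply/funext => x; case: (f x).
apply: (@measurableT_comp _ _ _ _ _ _ (@Num.sqrt R)) => //.
  by apply: continuous_measurable_fun; exact: sqrt_continuous.
by apply: measurable_funD; apply: measurable_funX.
Qed.

Let normcN_ge0 (f : T -> R[i]) x : (0 <= normc (f x))%R.
Proof. by case: (f x) => a b; rewrite sqrtr_ge0. Qed.

Lemma LnormcE (f : T -> R[i]) :
  (Lnorm mu 2%:E (fun x => (normc (f x))%:E) `^ 2 =
  \int[mu]_x (normc (f x) ^+ 2)%:E)%E.
Proof.
rewrite poweR_Lnorm//; apply: eq_integral => x _.
by rewrite gee0_abs ?lee_fin//= -powR_mulrn.
Qed.

Lemma LnormcE' (f : T -> R[i]) :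
  (Lnorm mu 2%:E (fun x => (normc (f x))%:E) =
  (\int[mu]_x (normc (f x) ^+ 2)%:E) `^ 2^-1)%E.
Proof.
by rewrite -LnormcE -poweRrM mulfV// poweRe1// Lnorm_ge0.
Qed.

Lemma Lnormc_lty (f : T -> R[i]) :
  (Lnorm mu 2%:E (fun x => (normc (f x))%:E) < +oo)%E <->
  (\int[mu]_x (normc (f x) ^+ 2)%:E < +oo)%E.
Proof.
split=> h; first by rewrite -LnormcE poweR_lty.
by rewrite LnormcE' poweR_lty.
Qed.

Lemma LnormcD (f g : T -> R[i]) : cmeasurable f -> cmeasurable g ->
  (Lnorm mu 2%:E (fun x => (normc (f x + g x))%:E) <=
   Lnorm mu 2%:E (fun x => (normc (f x))%:E) +
   Lnorm mu 2%:E (fun x => (normc (g x))%:E))%E.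
Proof.
move=> mf mg; have mfg : cmeasurable (fun x => f x + g x).
  case: mf mg => [f1 f2] [g1 g2]; split.
  - rewrite (_ : (fun x => _) =
      (fun x => complex.Re (f x) + complex.Re (g x))).
      exact: measurable_funD.
    by apply/funext => x; case: (f x) => ? ?; case: (g x).
  - rewrite (_ : (fun x => _) =
      (fun x => complex.Im (f x) + complex.Im (g x))).
      exact: measurable_funD.
    by apply/funext => x; case: (f x) => ? ?; case: (g x).
have := @eminkowski _ _ _ mu (fun x => normc (f x)) (fun x => normc (g x)) 2%:E
  (measurable_normc mf) (measurable_normc mg).
rewrite lee_fin ler1n => /(_ isT); apply: le_trans.
rewrite unlock /=; apply: gt0_ler_poweR => //.
- by rewrite in_itv/= leey integral_ge0.
- by rewrite in_itv/= leey integral_ge0.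
apply: ge0_le_integral => //.
- apply/measurable_EFinP.
  apply: (@measurableT_comp _ _ _ _ _ _ (fun x : R => x `^ 2)%R) => //.
  by apply: measurableT_comp => //; exact: measurable_normc.
- apply/measurable_EFinP.
  apply: (@measurableT_comp _ _ _ _ _ _ (fun x : R => x `^ 2)%R) => //.
  by apply: measurableT_comp => //; apply: measurable_funD;
    exact: measurable_normc.
- move=> x _; rewrite /= lee_fin ge0_ler_powR//.
  rewrite !ger0_norm ?addr_ge0//.
    exact: le_normcD.
  by have := normcN_ge0 (fun x => f x + g x) x.
Qed.

Lemma sq_integrable0 : sq_integrable mu (fun=> 0 : R[i]).
Proof.
split; first by split; exact: measurable_cst.
under eq_integral do rewrite /= expr0n/= addr0 sqrtr0 expr0n/=.
by rewrite integral0 ltry.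
Qed.

Lemma normcZ (a : R) (z : Rcomplex R) : normc (a *: z) = `|a| * normc z.
Proof.
case: z => x y; rewrite /GRing.scale/= !exprMn -mulrDr sqrtrM ?sqr_ge0//.
by rewrite sqrtr_sqr.
Qed.

Lemma sq_integrable_submod_closed : submod_closed sq_integrable_pred.
Proof.
split; first by rewrite inE/=; exact: sq_integrable0.
move=> a f g; rewrite !inE/= => -[mf If] [mg Ig].
have maf : cmeasurable (fun x => a *: f x : Rcomplex R).
  case: mf => f1 f2; split.
  - rewrite (_ : (fun x => _) = (fun x => a * complex.Re (f x))).
      exact: measurable_funM.
    by apply/funext => x; case: (f x).
  - rewrite (_ : (fun x => _) = (fun x => a * complex.Im (f x))).
      exact: measurable_funM.
    by apply/funext => x; case: (f x).
split.
  case: maf mg => [f1 f2] [g1 g2]; split.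
  - rewrite (_ : (fun x => _) =
      (fun x => complex.Re (a *: f x : Rcomplex R) + complex.Re (g x))).
      exact: measurable_funD.
    by apply/funext => x /=; rewrite -[LHS]/(complex.Re (a *: f x + g x));
      case: (_ *: _) => ? ?; case: (g x).
  - rewrite (_ : (fun x => _) =
      (fun x => complex.Im (a *: f x : Rcomplex R) + complex.Im (g x))).
      exact: measurable_funD.
    by apply/funext => x /=; rewrite -[LHS]/(complex.Im (a *: f x + g x));
      case: (_ *: _) => ? ?; case: (g x).
apply/Lnormc_lty; apply: le_lt_trans (LnormcD maf mg) _.
apply: lte_add_pinfty; apply/Lnormc_lty => //.
under eq_integral do rewrite normcZ exprMn EFinM.
rewrite ge0_integralZl_EFin ?sqr_ge0//.
- by rewrite lte_mul_pinfty// lee_fin sqr_ge0.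
- by move=> x _; rewrite lee_fin sqr_ge0.
- by apply/measurable_EFinP/measurable_funX; exact: measurable_normc.
Qed.

HB.instance Definition _ :=
  GRing.isSubmodClosed.Build R (T -> Rcomplex R) sq_integrable_pred
    sq_integrable_submod_closed.

Record L2fun := MkL2fun {
  L2fun_val :> T -> Rcomplex R ;
  _ : L2fun_val \in sq_integrable_pred }.

HB.instance Definition _ := [isSub for L2fun_val].
HB.instance Definition _ := [Choice of L2fun by <:].
HB.instance Definition _ := [SubChoice_isSubLmodule of L2fun by <:].

Definition null_pred : {pred L2fun} :=
  mem [set f : L2fun | {ae mu, forall x, f x = 0}].

Lemma null_zmod_closed : zmod_closed null_pred.
Proof.
split; first by rewrite inE/=; apply: nearW.
move=> f g; rewrite !inE/= => f0 g0; move: f0 g0; apply: filterS2 => x.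
by move=> fx gx; rewrite -[LHS]/(f x - g x) fx gx subr0.
Qed.

HB.instance Definition _ :=
  GRing.isZmodClosed.Build L2fun null_pred null_zmod_closed.

Definition L2 : Type := {quot null_pred}.
HB.instance Definition _ := Choice.on L2.
HB.instance Definition _ := EqQuotient.on L2.
HB.instance Definition _ := GRing.Zmodule.on L2.

Lemma eq_L2P (f g : L2fun) :
  \pi_L2 f = \pi_L2 g <-> {ae mu, forall x, f x = g x}.
Proof.
split.
  move/eqP; rewrite -idealrBE inE/=; apply: filterS => x.
  by move/eqP; rewrite subr_eq0 => /eqP.
move=> h; apply/eqP; rewrite -idealrBE inE/=; move: h; apply: filterS => x.
by move=> fg; apply/eqP; rewrite subr_eq0; apply/eqP.
Qed.

Definition L2scale (a : R) : L2 -> L2 := lift_op1 L2 ( *:%R a).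

Lemma pi_L2scale a : {morph \pi_L2 : f / a *: f >-> L2scale a f}.
Proof.
move=> f; unlock L2scale; apply/eq_L2P.
have /eq_L2P : \pi_L2 (repr (\pi_L2 f)) = \pi_L2 f by rewrite reprK.
by apply: filterS => x h; rewrite -[LHS]/(a *: f x) -h.
Qed.
Canonical pi_L2scale_morph a := PiMorph1 (pi_L2scale a).


Let L2scaleA a b (u : L2) : L2scale a (L2scale b u) = L2scale (a * b) u.
Proof. by rewrite -[u]reprK !piE scalerA. Qed.

Let L2scale1 : left_id 1 L2scale.
Proof. by move=> u; rewrite -[u]reprK !piE scale1r. Qed.

Let L2scaleDr : right_distributive L2scale +%R.
Proof.
by move=> a u v; rewrite -[u]reprK -[v]reprK !piE -scalerDr.
Qed.

Let L2scaleDl (u : L2) : {morph L2scale^~ u : a b / a + b}.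
Proof. by move=> a b; rewrite -[u]reprK !piE -scalerDl. Qed.

HB.instance Definition _ := GRing.Zmodule_isLmodule.Build R L2
  L2scaleA L2scale1 L2scaleDr L2scaleDl.

Let fnorm (f : T -> R[i]) : R :=
  Num.sqrt (fine (\int[mu]_x (normc (f x) ^+ 2)%:E)%E).

Definition L2norm (u : L2) : R :=
  Num.sqrt (fine (\int[mu]_x (normc (repr u x) ^+ 2)%:E)%E).

Lemma L2funP (f : L2fun) : sq_integrable mu f.
Proof. by have := valP f; rewrite inE. Qed.

Let fnormE (f : L2fun) :
  (fnorm f)%:E = Lnorm mu 2%:E (fun x => (normc (f x))%:E).
Proof.
have [mf If] := L2funP f.
rewrite LnormcE' /fnorm -(@fineK _ (\int[mu]_x (normc (f x) ^+ 2)%:E)%E).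
  rewrite poweR_EFin powR12_sqrt// fine_ge0// integral_ge0// => x _.
  by rewrite lee_fin sqr_ge0.
by rewrite ge0_fin_numE// integral_ge0// => x _; rewrite lee_fin sqr_ge0.
Qed.

Lemma L2norm_pi (f : L2fun) : L2norm (\pi_L2 f) =
  Num.sqrt (fine (\int[mu]_x (normc (f x) ^+ 2)%:E)%E).
Proof.
have /eq_L2P h : \pi_L2 (repr (\pi_L2 f)) = \pi_L2 f by rewrite reprK.
rewrite /L2norm; congr (Num.sqrt (fine _)).
apply: ae_eq_integral => //.
- apply/measurable_EFinP/measurable_funX/measurable_normc.
  by case: (L2funP (repr (\pi_L2 f))).
- by apply/measurable_EFinP/measurable_funX/measurable_normc; case: (L2funP f).
- by move: h; apply: filterS => x ->.
Qed.

Let ler_L2normD u v : L2norm (u + v) <= L2norm u + L2norm v.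
Proof.
rewrite -[u]reprK -[v]reprK; move: (repr u) (repr v) => f g.
have -> : \pi_L2 f + \pi_L2 g = \pi_L2 (f + g) by rewrite !piE.
rewrite !L2norm_pi -lee_fin EFinD.
rewrite -!/(fnorm _) !fnormE; apply: LnormcD.
  by case: (L2funP f).
by case: (L2funP g).
Qed.

Let L2normZ a u : L2norm (a *: u) = `|a| * L2norm u.
Proof.
rewrite -[u]reprK; move: (repr u) => f.
have -> : a *: \pi_L2 f = \pi_L2 (a *: f) by rewrite (pi_L2scale a f).
rewrite !L2norm_pi.
have [mf If] := L2funP f.
under eq_integral do rewrite normcZ exprMn EFinM.
rewrite ge0_integralZl_EFin ?sqr_ge0//.
- rewrite fineM//; last first.
    rewrite ge0_fin_numE// integral_ge0// => x _.
    by rewrite lee_fin sqr_ge0.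
  by rewrite sqrtrM ?sqr_ge0//= sqrtr_sqr normr_id.
- by move=> x _; rewrite lee_fin sqr_ge0.
- by apply/measurable_EFinP/measurable_funX; exact: measurable_normc.
Qed.

Let L2norm0_eq0 u : L2norm u = 0 -> u = 0.
Proof.
rewrite -[u]reprK L2norm_pi -/(fnorm _); move: (repr u) => f /eqP.
rewrite -eqe fnormE => /eqP /Lnorm_eq0_eq0 f0.
have -> : 0 = \pi_L2 0 :> L2 by rewrite !piE.
apply/eq_L2P.
have : (fun x => (normc (f x))%:E) = \0 %[ae mu].
  apply: f0 => //.
  by apply/measurable_EFinP/measurable_normc; case: (L2funP f).
apply: filterS => x /(_ Logic.I) [] /eq0_normc ->.
by [].
Qed.

HB.instance Definition _ := Lmodule_isNormed.Build R L2
  ler_L2normD L2normZ L2norm0_eq0.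

End L2.

(* Only meaningful when f is square integrable, see [toL2E]; otherwise it is 0
   by convention. *)
Definition toL2 d (T : measurableType d) (R : realType)
    (mu : {measure set T -> \bar R}) (f : T -> R[i]) : L2 mu :=
  \pi_(L2 mu) (insubd 0 (f : T -> Rcomplex R)).

Lemma toL2E d (T : measurableType d) (R : realType)
    (mu : {measure set T -> \bar R}) (f : T -> R[i]) :
  sq_integrable mu f -> {ae mu, forall x, repr (toL2 mu f) x = f x}.
Proof.
move=> If; have fP : (f : T -> Rcomplex R) \in sq_integrable_pred mu.
  by rewrite inE.
have /eq_L2P : \pi_(L2 mu) (repr (toL2 mu f)) = toL2 mu f by rewrite reprK.
apply: filterS => x ->.
by have /(congr1 (fun g => g x)) := insubdK (0 : L2fun mu) fP.
Qed.

Definition L2dot d (T : measurableType d) (R : realType)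
    (mu : {measure set T -> \bar R}) (u v : L2 mu) : R[i] :=
  cintegral mu (fun x => (repr u x : R[i]) * (repr v x : R[i])^*%C).

(* The subset H of V is a real Hilbert space for the scalar product dot, the
   norm of V being the one induced by dot on H. *)
Definition real_hilbert_space (R : realType) (V : normedModType R)
    (H : set V) (dot : V -> V -> R[i]) : Prop :=
  [/\ H 0 /\ (forall (a : R) u v, H u -> H v -> H (a *: u + v)),
      forall u v, H u -> H v -> complex.Im (dot u v) = 0,
      (forall u v, H u -> H v -> dot u v = dot v u) /\
      (forall (a : R) u v w, H u -> H v -> H w ->
        dot (a *: u + v) w = a%:C * dot u w + dot v w),
      (forall u, H u -> 0 <= dot u u /\ (dot u u = 0 -> u = 0)) /\
      (forall u, H u -> (`|u| ^+ 2)%:C = dot u u) &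
      forall u_ : nat -> V, (forall n, H (u_ n)) -> cauchy (u_ @ \oo) ->
        exists2 l, H l & u_ @ \oo --> l].

Definition in_cube (R : realType) (nu : nat) (x : nu.-tuple R) : bool :=
  [forall k, - pi <= tnth x k < pi].

Definition torus (R : realType) (nu : nat) : Type :=
  {x : nu.-tuple R | in_cube x}.

Section torus.
Variables (R : realType) (nu : nat).
Local Notation torus := (torus R nu).

HB.instance Definition _ := Choice.on torus.

Lemma torus_point_subproof :
  in_cube [tuple (- pi : R) | _ < nu].
Proof.
by apply/forallP => k; rewrite tnth_mktuple lexx/= gtrN// pi_gt0.
Qed.

HB.instance Definition _ :=
  isPointed.Build torus (exist (@in_cube R nu) _ torus_point_subproof).

Definition torus_coord (x : torus) : nu.-tuple R := sval x.

(* Borel sets of R^nu contained in the cube. *)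
HB.instance Definition _ :=
  Measurable.copy torus (g_sigma_algebra_preimageType torus_coord).

Lemma torus_opp_subproof (x : torus) : in_cube
  [tuple if tnth (sval x) k == - pi then - pi else - tnth (sval x) k
  | k < nu].
Proof.
apply/forallP => k; rewrite tnth_mktuple.
have /forallP/(_ k)/andP[xl xr] := svalP x.
case: ifPn => [_|xN]; first by rewrite lexx/= gtrN// pi_gt0.
by rewrite lerNl opprK (ltW xr)/= ltrNl lt_neqAle eq_sym xN.
Qed.

(* The coordinate - pi is identified with pi, hence is its own opposite. *)
Definition torus_opp (x : torus) : torus :=
  exist (@in_cube R nu) _ (torus_opp_subproof x).

Definition character (p : 'I_nu -> int) (x : torus) : R[i] :=
  let px := \sum_k (p k)%:~R * tnth (torus_coord x) k in cos px +i* sin px.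

End torus.

(* Charges take finite values, so that the total variation is finite. *)
Record complex_measure d (T : measurableType d) (R : realType) :=
  ComplexMeasure {
    re_measure : {charge set T -> \bar R} ;
    im_measure : {charge set T -> \bar R} }.

Definition cmeasure_val d (T : measurableType d) (R : realType)
    (m : complex_measure T R) (A : set T) : R[i] :=
  fine (re_measure m A) +i* fine (im_measure m A).
Coercion cmeasure_val : complex_measure >-> Funclass.

Definition cdominates d (T : measurableType d) (R : realType)
    (m : complex_measure T R) (mu : set T -> \bar R) : Prop :=
  re_measure m `<< mu /\ im_measure m `<< mu.

Definition cdensity d (T : measurableType d) (R : realType)
    (m : complex_measure T R) (mu : {finite_measure set T -> \bar R})
    (x : T) : R[i] :=
  fine (Radon_Nikodym (re_measure m) mu x) +i*
  fine (Radon_Nikodym (im_measure m) mu x).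

Definition positive_semidefinite (R : realType) (n : nat) (M : 'M[R[i]]_n) :
    Prop :=
  forall v : 'I_n -> R[i], 0 <= \sum_j \sum_k v j * M j k * (v k)^*%C.

Lemma positive_semidefinite_diag (R : realType) (n : nat) (M : 'M[R[i]]_n) :
  positive_semidefinite M -> forall j, 0 <= M j j.
Proof.
move=> psd j; have /= := psd (fun k => (k == j)%:R).
rewrite (bigD1 j)//= (bigD1 j)//= !big1/=; last 2 first.
- by move=> k kj; rewrite big1// => l _; rewrite (negbTE kj) !mul0r.
- by move=> k kj; rewrite (negbTE kj) conjc_nat mulr0.
by rewrite eqxx mul1r conjc_nat mulr1 !addr0.
Qed.

Record spectral_measure (R : realType) (nu d : nat) := SpectralMeasure {
  spectral_entry :> 'I_d -> 'I_d -> complex_measure (torus R nu) R ;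
  spectral_psd : exists mu : {finite_measure set (torus R nu) -> \bar R},
    (forall j k, cdominates (spectral_entry j k) mu) /\
    {ae mu, forall x, positive_semidefinite
                        (\matrix_(j, k) cdensity (spectral_entry j k) mu x)} ;
  spectral_sym : forall j k (A : set (torus R nu)), measurable A ->
    spectral_entry j k (@torus_opp R nu @` A) = (spectral_entry j k A)^*%C }.

Section diagonal.
Variables (R : realType) (nu d : nat) (G : spectral_measure R nu d).

Lemma diagonal_ge0 (j : 'I_d) A :
  (0 <= crestr0 (re_measure (G j j)) measurableT A)%E.
Proof.
rewrite /crestr0; case: ifPn => //; rewrite inE /crestr setIT => mA.
have [mu [/(_ j j)[Gmu _] psd]] := spectral_psd G.
rewrite (Radon_Nikodym_integral Gmu mA).
set f := Radon_Nikodym _ _.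
have mf : measurable_fun A f.
  apply: measurable_funTS.
  exact: (measurable_int _ (Radon_Nikodym_integrable Gmu)).
rewrite (@ae_eq_integral _ _ _ mu _ f^\+%E f)//.
- by apply: integral_ge0 => x _; exact: funepos_ge0.
- exact: measurable_funepos.
move: psd; apply: filterS => x psd _.
rewrite funeposE; apply/esym/max_idPl.
have := positive_semidefinite_diag psd j.
rewrite mxE /cdensity lecE/= => /andP[_].
by rewrite -/f -lee_fin fineK// Radon_Nikodym_fin_num.
Qed.

End diagonal.

(* G_{j,j} as a positive measure, see [diag_measureE]. *)
Definition diag_measure (R : realType) (nu d : nat)
    (G : spectral_measure R nu d) (j : 'I_d) : {measure set (torus R nu) -> \bar R} :=
  measure_of_charge _ (diagonal_ge0 G j).

Lemma diag_measureE (R : realType) (nu d : nat) (G : spectral_measure R nu d)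
    (j : 'I_d) (A : set (torus R nu)) : measurable A ->
  G j j A = (fine (diag_measure G j A))%:C.
Proof.
move=> mA; rewrite /cmeasure_val /= /measure_of_charge /crestr0 mem_set//.
rewrite /crestr setIT; congr (_ +i* _).
have [mu [/(_ j j)[_ Gmu] psd]] := spectral_psd G.
rewrite (Radon_Nikodym_integral Gmu mA); set f := Radon_Nikodym _ _.
rewrite (@ae_eq_integral _ _ _ mu _ (cst 0%E) f)//.
- by rewrite integral0.
- apply: measurable_funTS.
  exact: (measurable_int _ (Radon_Nikodym_integrable Gmu)).
- move: psd; apply: filterS => x /positive_semidefinite_diag psd _.
  move: (psd j); rewrite mxE /cdensity lecE/= => /andP[/eqP f0 _].
  by rewrite -[LHS]fineK ?Radon_Nikodym_fin_num// f0.
Qed.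

(* As a subset of L2, so that almost everywhere equal functions are identified;
   the symmetry is required everywhere of some representative. *)
Definition K1 (R : realType) (nu d : nat) (G : spectral_measure R nu d)
    (j : 'I_d) : set (L2 (diag_measure G j)) :=
  [set toL2 (diag_measure G j) u | u in [set u : torus R nu -> R[i] |
    sq_integrable (diag_measure G j) u /\
    forall x, u (torus_opp x) = (u x)^*%C]].

(* [normal_prob] is only the normal law for a nonzero standard deviation. *)
Definition gaussian d (T : measurableType d) (R : realType)
    (P : probability T R) (X : T -> R) : Prop :=
  measurable_fun [set: T] X /\
  exists m s : R, forall B : set R, measurable B ->
    P (X @^-1` B) = if s == 0 then \d_m B else normal_prob m s B.

Definition jointly_gaussian d (T : measurableType d) (R : realType)
    (P : probability T R) (I : finType) (X : I -> T -> R) : Prop :=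
  forall a : I -> R, gaussian P (fun w => \sum_i a i * X i w).

Record random_spectral_measure (R : realType) (nu d : nat)
    (G : spectral_measure R nu d) (dO : measure_display)
    (Omega : measurableType dO) (P : probability Omega R) :=
  RandomSpectralMeasure {
  rsm_val :> 'I_d -> set (torus R nu) -> Omega -> R[i] ;
  (* implied by joint Gaussianity; it makes the integrals below meaningful *)
  rsm_sq_integrable : forall j A, measurable A ->
    sq_integrable P (rsm_val j A) ;
  rsm_gaussian : forall n (j : 'I_n -> 'I_d) (A : 'I_n -> set (torus R nu)),
    (forall s, measurable (A s)) ->
    jointly_gaussian P (fun (q : 'I_n * bool) w =>
      if q.2 then complex.Re (rsm_val (j q.1) (A q.1) w)
      else complex.Im (rsm_val (j q.1) (A q.1) w)) ;
  rsm_centered : forall j A, measurable A -> cintegral P (rsm_val j A) = 0 ;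
  rsm_covariance : forall j k A B, measurable A -> measurable B ->
    cintegral P (fun w => rsm_val j A w * (rsm_val k B w)^*%C) =
    G j k (A `&` B) ;
  (* equalities of random variables hold with probability 1 *)
  rsm_additive : forall j n (A : 'I_n -> set (torus R nu)),
    (forall s, measurable (A s)) -> trivIset [set: 'I_n] A ->
    {ae P, forall w,
      \sum_s rsm_val j (A s) w = rsm_val j (\bigcup_s A s) w} ;
  rsm_sym : forall j A, measurable A ->
    {ae P, forall w,
      rsm_val j A w = (rsm_val j (@torus_opp R nu @` A) w)^*%C} }.

Section random_integral.
Variables (R : realType) (nu d : nat) (G : spectral_measure R nu d).
Variables (dO : measure_display) (Omega : measurableType dO).
Variables (P : probability Omega R) (Z : random_spectral_measure G P).

Definition extends_simple_integral (j : 'I_d)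
    (I : L2 (diag_measure G j) -> L2 P) : Prop :=
  forall n (c : 'I_n -> R[i]) (A : 'I_n -> set (torus R nu)),
    (forall s, measurable (A s)) -> trivIset [set: 'I_n] A ->
    I (toL2 (diag_measure G j) (fun x => \sum_s c s * \1_(A s) x)) =
    toL2 P (fun w => \sum_s c s * Z j (A s) w).

(* The continuous extension of the integral of simple functions is unique, as
   simple functions are dense in L2; the default value 0 of [xget] would only be
   used if there were no such extension. *)
Definition random_integral (j : 'I_d) (u : L2 (diag_measure G j)) : L2 P :=
  xget (fun=> 0) [set I | continuous I /\ extends_simple_integral I] u.

Definition stationary_field (j : 'I_d) (p : 'I_nu -> int) : L2 P :=
  @random_integral j (toL2 (diag_measure G j) (character p)).

(* Closed real linear span in the complex L2 space of P; that the scalar product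
   is real on it is part of [real_hilbert_space]. *)
Definition H1 (j : 'I_d) : set (L2 P) :=
  closure [set X | exists n (c : 'I_n -> R) (p : 'I_n -> 'I_nu -> int),
    X = \sum_k c k *: stationary_field j (p k)].

End random_integral.

Arguments K1 {R nu d} G j _.
Arguments H1 {R nu d G dO Omega P} Z j _.
Arguments random_integral {R nu d G dO Omega P} Z j u.

(* Main.v *)
(* The Gram matrices of the indicators of Borel sets in L2(G_jj) and of the
   variables Z_j(A) in L2(P) coincide, so the integral of simple functions is a
   complex linear isometry; simple functions are dense and L2(P) is complete, so
   it extends to an isometry of L2(G_jj) preserving the complex scalar product.
   The space K1 is the range of the contraction f |-> (f + conj (f o opp)) / 2,
   hence closed, and its scalar product is real because G_jj is invariant under
   x |-> -x.  It remains to see that real combinations of characters are dense in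
   K1.  This contraction maps c e_p to Re(c) e_p, so it suffices that complex
   trigonometric polynomials are dense in L2(G_jj).  Bounded functions that are L2
   limits of trigonometric polynomials form an algebra closed under bounded
   pointwise limits, so the sets whose indicator is of this kind form a
   sigma-algebra; it contains the half-spaces {a <= x_k}, which are described by
   inequalities on cos x_k and sin x_k. *)
Require Import Defs.
From HB Require Import structures.
From mathcomp Require Import all_boot all_order all_algebra complex.
From mathcomp Require Import generic_quotient ring_quotient ring lra.
From mathcomp Require Import all_classical all_reals all_analysis.
From mathcomp Require Import measurable_realfun.
Import Order.TTheory GRing.Theory Num.Theory.
Import numFieldNormedType.Exports.
Import Normc Quotient.

Set Implicit Arguments.
Unset Strict Implicit.
Unset Printing Implicit Defensive.

Local Open Scope classical_set_scope.
Local Open Scope ring_scope.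
Local Open Scope complex_scope.
Local Open Scope quotient_scope.

(** * Complex square integrable functions *)

(** [L2] is a vector space over the reals only, so the isometric extension yields real linearity and
    the norm, hence by polarization the real part of the scalar product. The imaginary part is
    recovered from multiplication by the imaginary unit, with which the integral is shown to
    commute. The full complex product has to be carried over because [H1] lives in the complex
    [L2 P], and the reality of the product on [H1] is part of the claim; it is inherited from [K1].

    [random_integral] is a choice among continuous extensions, so existence and uniqueness of such
    an extension precede every statement about it.

    The torus is a half-open cube. Its coordinates are not periodic, and the reflection keeps a
    coordinate equal to [- pi] instead of negating it. This shapes the measurability of the
    reflection, the symmetry of the characters, and the description of half-spaces, where the cosine
    alone does not separate [x_k] from [- x_k] and the sign of the sine has to decide. *)

Section complex_numbers.
Variable R : realType.
Implicit Types z w : R[i].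

Lemma normc_ge0 z : 0 <= normc z.
Proof. by case: z => a b; rewrite sqrtr_ge0. Qed.

Lemma normc_sqr z : normc z ^+ 2 = complex.Re z ^+ 2 + complex.Im z ^+ 2.
Proof. by case: z => a b /=; rewrite sqr_sqrtr// addr_ge0// sqr_ge0. Qed.

Lemma normcJ z : normc z^*%C = normc z.
Proof. by case: z => a b /=; rewrite sqrrN. Qed.

Lemma normcR (a : R) : normc a%:C = `|a|.
Proof. by rewrite /= expr0n/= addr0 sqrtr_sqr. Qed.

Lemma ler_normcD z w : normc (z + w) <= normc z + normc w.
Proof. exact: (@le_normcD R z w). Qed.

Lemma normcRe_le z : `|complex.Re z| <= normc z.
Proof.
rewrite -ler_sqr ?nnegrE ?normc_ge0// normc_sqr real_normK ?num_real//.
by rewrite lerDl sqr_ge0.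
Qed.

Lemma normcIm_le z : `|complex.Im z| <= normc z.
Proof.
rewrite -ler_sqr ?nnegrE ?normc_ge0// normc_sqr real_normK ?num_real//.
by rewrite lerDr sqr_ge0.
Qed.

Lemma normc_le_ReIm z : normc z <= `|complex.Re z| + `|complex.Im z|.
Proof.
rewrite -ler_sqr ?nnegrE ?normc_ge0 ?addr_ge0// normc_sqr sqrrD.
rewrite !real_normK ?num_real//.
by have := mulr_ge0 (normr_ge0 (complex.Re z)) (normr_ge0 (complex.Im z)); lra.
Qed.

Lemma ReD z w : complex.Re (z + w) = complex.Re z + complex.Re w.
Proof. by case: z w => a b [c d]. Qed.

Lemma ImD z w : complex.Im (z + w) = complex.Im z + complex.Im w.
Proof. by case: z w => a b [c d]. Qed.

Lemma ReB z w : complex.Re (z - w) = complex.Re z - complex.Re w.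
Proof. by case: z w => a b [c d]. Qed.

Lemma ImB z w : complex.Im (z - w) = complex.Im z - complex.Im w.
Proof. by case: z w => a b [c d]. Qed.

Lemma ReM z w : complex.Re (z * w) =
  complex.Re z * complex.Re w - complex.Im z * complex.Im w.
Proof. by case: z w => a b [c d]. Qed.

Lemma ImM z w : complex.Im (z * w) =
  complex.Re z * complex.Im w + complex.Im z * complex.Re w.
Proof. by case: z w => a b [c d]. Qed.

Lemma ReJ z : complex.Re z^*%C = complex.Re z.
Proof. by case: z. Qed.

Lemma ImJ z : complex.Im z^*%C = - complex.Im z.
Proof. by case: z. Qed.

Lemma eqc_ReIm z w : complex.Re z = complex.Re w -> complex.Im z = complex.Im w -> z = w.
Proof. by case: z w => a b [c d] /= -> ->. Qed.

Lemma mulJE z w : z * w^*%C =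
  (complex.Re z * complex.Re w + complex.Im z * complex.Im w) +i*
  (complex.Im z * complex.Re w - complex.Re z * complex.Im w).
Proof. by apply: eqc_ReIm; rewrite ?(ReM, ImM, ReJ, ImJ) /=; ring. Qed.

Lemma Rcomplex_scaleE (a : R) z : (a *: (z : Rcomplex R) : Rcomplex R) = a%:C * z :> R[i].
Proof. by case: z => x y; simpc. Qed.

Lemma conjcD z w : (z + w)^*%C = z^*%C + w^*%C.
Proof. exact: rmorphD. Qed.

Lemma conjcB z w : (z - w)^*%C = z^*%C - w^*%C.
Proof. exact: rmorphB. Qed.

Lemma conjcM z w : (z * w)^*%C = z^*%C * w^*%C.
Proof. exact: rmorphM. Qed.

End complex_numbers.

Section cmeasurable.
Context d (T : measurableType d) (R : realType).
Implicit Types f g : T -> R[i].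

Lemma cmeasurable_cst (c : R[i]) : cmeasurable (fun _ : T => c).
Proof. by split; exact: measurable_cst. Qed.

Lemma cmeasurable_real (f : T -> R) : measurable_fun [set: T] f ->
  cmeasurable (fun x => (f x)%:C).
Proof. by move=> mf; split => //=; exact: measurable_cst. Qed.

Lemma cmeasurableD f g : cmeasurable f -> cmeasurable g ->
  cmeasurable (fun x => f x + g x).
Proof.
move=> [f1 f2] [g1 g2]; split.
- by under eq_fun do rewrite ReD; exact: measurable_funD.
- by under eq_fun do rewrite ImD; exact: measurable_funD.
Qed.

Lemma cmeasurableM f g : cmeasurable f -> cmeasurable g ->
  cmeasurable (fun x => f x * g x).
Proof.
move=> [f1 f2] [g1 g2]; split.
- by under eq_fun do rewrite ReM; apply: measurable_funB; exact: measurable_funM.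
- by under eq_fun do rewrite ImM; apply: measurable_funD; exact: measurable_funM.
Qed.

Lemma cmeasurableB f g : cmeasurable f -> cmeasurable g ->
  cmeasurable (fun x => f x - g x).
Proof.
move=> [f1 f2] [g1 g2]; split.
- by under eq_fun do rewrite ReB; exact: measurable_funB.
- by under eq_fun do rewrite ImB; exact: measurable_funB.
Qed.

Lemma cmeasurableJ f : cmeasurable f -> cmeasurable (fun x => (f x)^*%C).
Proof.
move=> [f1 f2]; split.
- by under eq_fun do rewrite ReJ.
- by under eq_fun do rewrite ImJ; exact: measurable_funN.
Qed.

Lemma cmeasurable_indic (A : set T) : measurable A ->
  cmeasurable (fun x => \1_A x : R[i]).
Proof.
move=> mA; rewrite (_ : (fun x => _) = (fun x => (\1_A x : R)%:C)).
  by apply: cmeasurable_real; exact: measurable_indic.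
by apply/funext => x; rewrite !indicE; case: (x \in A).
Qed.

Lemma cmeasurable_comp d' (T' : measurableType d') (h : T' -> T) f :
  cmeasurable f -> measurable_fun [set: T'] h -> cmeasurable (f \o h).
Proof.
by move=> [f1 f2] mh; split; [exact: (measurableT_comp f1)|exact: (measurableT_comp f2)].
Qed.

End cmeasurable.

Section square_integrable.
Context d (T : measurableType d) (R : realType).
Variable mu : {measure set T -> \bar R}.
Implicit Types f g : T -> R[i].

Lemma measurable_normc_sqr f : cmeasurable f ->
  measurable_fun [set: T] (fun x => (normc (f x) ^+ 2)%:E).
Proof. by move=> mf; apply/measurable_EFinP/measurable_funX/measurable_normc. Qed.

Lemma sq_integrable_le f g (M : R) : cmeasurable f -> sq_integrable mu g ->
  (forall x, normc (f x) <= M * normc (g x)) -> sq_integrable mu f.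
Proof.
move=> mf [mg Ig] fg; split => //.
apply: (@le_lt_trans _ _ (\int[mu]_x ((M ^+ 2)%:E * (normc (g x) ^+ 2)%:E))%E).
  apply: ge0_le_integral => //.
  - by move=> x _; rewrite lee_fin sqr_ge0.
  - exact: measurable_normc_sqr.
  - by apply: emeasurable_funM; [exact: measurable_cst|exact: measurable_normc_sqr].
  - move=> x _; rewrite -EFinM lee_fin -exprMn lerXn2r// nnegrE ?normc_ge0//.
    exact: le_trans (normc_ge0 _) (fg x).
rewrite ge0_integralZl_EFin ?sqr_ge0//.
- by rewrite lte_mul_pinfty// lee_fin sqr_ge0.
- by move=> x _; rewrite lee_fin sqr_ge0.
- exact: measurable_normc_sqr.
Qed.

Lemma sq_integrableD f g : sq_integrable mu f -> sq_integrable mu g ->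
  sq_integrable mu (fun x => f x + g x).
Proof.
move=> If Ig; have [_ /(_ 1 f g)] := sq_integrable_submod_closed mu.
by rewrite scale1r !inE/=; exact.
Qed.

Lemma sq_integrableM (c : R[i]) f : sq_integrable mu f ->
  sq_integrable mu (fun x => c * f x).
Proof.
move=> If; apply: (@sq_integrable_le _ f (normc c)) => //.
  by apply: cmeasurableM; [exact: cmeasurable_cst|case: If].
by move=> x; rewrite normcM.
Qed.

Lemma sq_integrableB f g : sq_integrable mu f -> sq_integrable mu g ->
  sq_integrable mu (fun x => f x - g x).
Proof.
move=> If Ig; rewrite (_ : (fun x => _) = (fun x => f x + -1 * g x)).
  by apply: sq_integrableD => //; exact: sq_integrableM.
by apply/funext => x; rewrite mulN1r.
Qed.

Lemma sq_integrable_sum I (r : seq I) (P : pred I) (F : I -> T -> R[i]) :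
  (forall i, P i -> sq_integrable mu (F i)) ->
  sq_integrable mu (fun x => \sum_(i <- r | P i) F i x).
Proof.
move=> IF; elim: r => [|i r IH].
  by under eq_fun do rewrite big_nil; exact: sq_integrable0.
under eq_fun do rewrite big_cons; case: (boolP (P i)) => [Pi|_] //.
by apply: sq_integrableD => //; exact: IF.
Qed.

Lemma sq_integrable_bounded f (M : R) : (mu [set: T] < +oo)%E ->
  cmeasurable f -> (forall x, normc (f x) <= M) -> sq_integrable mu f.
Proof.
move=> mufin mf fM.
have I1 : sq_integrable mu (fun=> 1 : R[i]).
  split; first exact: cmeasurable_cst.
  under eq_integral do rewrite [normc 1]normc1 expr1n.
  by rewrite integral_cst// mul1e.
by apply: (@sq_integrable_le _ _ M mf I1) => x; rewrite [normc 1]normc1 mulr1.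
Qed.

(** [toL2] packs [f] through [insubd]; a named representative with underlying function [f] lets the
    quotient lemmas about [\pi] apply to plain functions. *)
Lemma L2funE (f : T -> R[i]) : sq_integrable mu f ->
  exists2 F : L2fun mu, (F : T -> Rcomplex R) = f & toL2 mu f = \pi_(L2 mu) F.
Proof.
move=> If; have fP : (f : T -> Rcomplex R) \in sq_integrable_pred mu by rewrite inE.
by exists (insubd 0 (f : T -> Rcomplex R)) => //; rewrite [LHS](insubdK _ fP).
Qed.

Lemma toL2_repr (u : L2 mu) : toL2 mu (repr u) = u.
Proof.
have [F FE ->] := L2funE (L2funP (repr u)).
by rewrite -[RHS]reprK; congr (\pi_(_) _); exact: val_inj.
Qed.

Lemma toL2_ex (u : L2 mu) : exists2 f, sq_integrable mu f & u = toL2 mu f.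
Proof. by exists (repr u); [exact: L2funP|rewrite toL2_repr]. Qed.

Lemma eq_toL2 f g : sq_integrable mu f -> sq_integrable mu g ->
  {ae mu, forall x, f x = g x} -> toL2 mu f = toL2 mu g.
Proof.
move=> /L2funE[F <- ->] /L2funE[F' <- ->] fg; exact/eq_L2P.
Qed.

Lemma toL2D f g : sq_integrable mu f -> sq_integrable mu g ->
  toL2 mu (fun x => f x + g x) = toL2 mu f + toL2 mu g.
Proof.
move=> If Ig.
have [F FE ->] := L2funE If; have [F' FE' ->] := L2funE Ig.
have [F'' FE'' ->] := L2funE (sq_integrableD If Ig).
have -> : \pi_(L2 mu) F + \pi_(L2 mu) F' = \pi_(L2 mu) (F + F') by rewrite !piE.
by congr (\pi_(_) _); apply: val_inj; rewrite /= FE'' -FE -FE'.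
Qed.

Lemma toL2Z (a : R) f : sq_integrable mu f ->
  toL2 mu (fun x => a%:C * f x) = a *: toL2 mu f.
Proof.
move=> If.
have [F FE ->] := L2funE If; have [F' FE' ->] := L2funE (sq_integrableM a%:C If).
have -> : a *: \pi_(L2 mu) F = \pi_(L2 mu) (a *: F) by rewrite (pi_L2scale a F).
congr (\pi_(_) _); apply: val_inj; rewrite /= FE'; apply/funext => x.
by rewrite -FE -Rcomplex_scaleE.
Qed.

Lemma toL20 : toL2 mu (fun=> 0) = 0.
Proof.
by rewrite -(scale0r (toL2 mu (fun=> 0))) -toL2Z ?mul0r//; exact: sq_integrable0.
Qed.

Lemma toL2B f g : sq_integrable mu f -> sq_integrable mu g ->
  toL2 mu (fun x => f x - g x) = toL2 mu f - toL2 mu g.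
Proof.
move=> If Ig; rewrite -scaleN1r -toL2Z// -toL2D//; last exact: sq_integrableM.
by congr (toL2 mu _); apply/funext => x; rewrite rmorphN1 mulN1r.
Qed.

Lemma toL2_sum I (r : seq I) (P : pred I) (F : I -> T -> R[i]) :
  (forall i, P i -> sq_integrable mu (F i)) ->
  toL2 mu (fun x => \sum_(i <- r | P i) F i x) = \sum_(i <- r | P i) toL2 mu (F i).
Proof.
move=> IF; elim: r => [|i r IH].
  by under eq_fun do rewrite big_nil; rewrite big_nil toL20.
rewrite big_cons; under eq_fun do rewrite big_cons; case: (boolP (P i)) => [Pi|_] //.
by rewrite toL2D ?IH//; [exact: IF|exact: sq_integrable_sum].
Qed.

Lemma norm_toL2 f : sq_integrable mu f ->
  `|toL2 mu f| = Num.sqrt (fine (\int[mu]_x (normc (f x) ^+ 2)%:E)%E).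
Proof. by move=> /L2funE[F <- ->]; exact: L2norm_pi. Qed.

Lemma sqr_norm_toL2 f : sq_integrable mu f ->
  ((`|toL2 mu f| ^+ 2)%:E = \int[mu]_x (normc (f x) ^+ 2)%:E)%E.
Proof.
move=> If; have i0 : (0 <= \int[mu]_x (normc (f x) ^+ 2)%:E)%E.
  by apply: integral_ge0 => x _; rewrite lee_fin sqr_ge0.
rewrite norm_toL2// sqr_sqrtr ?fine_ge0// fineK// ge0_fin_numE//.
by case: If.
Qed.

End square_integrable.

(** * Complex integrals and the scalar product of L2 *)

Section scalar_product.
Context d (T : measurableType d) (R : realType).
Variable mu : {measure set T -> \bar R}.
Implicit Types f g h : T -> R[i].

Definition cintegrable f : Prop :=
  mu.-integrable [set: T] (EFin \o (fun x => complex.Re (f x))) /\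
  mu.-integrable [set: T] (EFin \o (fun x => complex.Im (f x))).

Lemma cintegrableD f g : cintegrable f -> cintegrable g ->
  cintegrable (fun x => f x + g x).
Proof.
move=> [f1 f2] [g1 g2]; split.
- rewrite (_ : EFin \o _ = (EFin \o (fun x => complex.Re (f x))) \+
    (EFin \o (fun x => complex.Re (g x))))%E; last first.
    by apply/funext => x /=; rewrite ReD.
  exact: integrableD.
- rewrite (_ : EFin \o _ = (EFin \o (fun x => complex.Im (f x))) \+
    (EFin \o (fun x => complex.Im (g x))))%E; last first.
    by apply/funext => x /=; rewrite ImD.
  exact: integrableD.
Qed.

Lemma cintegrable0 : cintegrable (fun=> 0).
Proof. by split; exact: integrable0. Qed.

Lemma cintegrable_sum I (r : seq I) (F : I -> T -> R[i]) :
  (forall i, cintegrable (F i)) -> cintegrable (fun x => \sum_(i <- r) F i x).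
Proof.
move=> IF; elim: r => [|i r IH].
  by under eq_fun do rewrite big_nil; exact: cintegrable0.
by under eq_fun do rewrite big_cons; exact: cintegrableD.
Qed.

Let integrable_lin (a b : R) (f g : T -> R) :
  mu.-integrable [set: T] (EFin \o f) -> mu.-integrable [set: T] (EFin \o g) ->
  mu.-integrable [set: T] (EFin \o (fun x => a * f x + b * g x)) /\
  Rintegral mu [set: T] (fun x => a * f x + b * g x) =
  a * Rintegral mu [set: T] f + b * Rintegral mu [set: T] g.
Proof.
move=> If Ig.
have Iaf : mu.-integrable [set: T] (EFin \o (fun x => a * f x)).
  by rewrite (_ : EFin \o _ = (fun x => a%:E * (EFin \o f) x)%E)//; exact: integrableZl.
have Ibg : mu.-integrable [set: T] (EFin \o (fun x => b * g x)).
  by rewrite (_ : EFin \o _ = (fun x => b%:E * (EFin \o g) x)%E)//; exact: integrableZl.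
split; last by rewrite RintegralD// !RintegralZl.
by rewrite (_ : EFin \o _ = (EFin \o (fun x => a * f x)%R) \+ (EFin \o (fun x => b * g x)%R))%E//; exact: integrableD.
Qed.

Lemma cintegrableM (c : R[i]) f : cintegrable f -> cintegrable (fun x => c * f x).
Proof.
move=> [f1 f2]; split.
- rewrite (_ : (fun x => complex.Re (c * f x)) = (fun x => complex.Re c * complex.Re (f x)
    + (- complex.Im c) * complex.Im (f x))).
    by have [] := integrable_lin (complex.Re c) (- complex.Im c) f1 f2.
  by apply/funext => x; rewrite ReM mulNr.
- rewrite (_ : (fun x => complex.Im (c * f x)) = (fun x => complex.Re c * complex.Im (f x)
    + complex.Im c * complex.Re (f x))).
    by have [] := integrable_lin (complex.Re c) (complex.Im c) f2 f1.
  by apply/funext => x; rewrite ImM.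
Qed.

Lemma cintegralD f g : cintegrable f -> cintegrable g ->
  cintegral mu (fun x => f x + g x) = cintegral mu f + cintegral mu g.
Proof.
move=> [f1 f2] [g1 g2]; apply: eqc_ReIm; rewrite ?ReD ?ImD /=.
- by under eq_Rintegral do rewrite ReD; rewrite RintegralD.
- by under eq_Rintegral do rewrite ImD; rewrite RintegralD.
Qed.

Lemma cintegralM (c : R[i]) f : cintegrable f ->
  cintegral mu (fun x => c * f x) = c * cintegral mu f.
Proof.
move=> [f1 f2]; apply: eqc_ReIm; rewrite ?ReM ?ImM /=.
- under eq_Rintegral do rewrite ReM -mulNr.
  by have [_ ->] := integrable_lin (complex.Re c) (- complex.Im c) f1 f2; rewrite mulNr.
- under eq_Rintegral do rewrite ImM.
  by have [_ ->] := integrable_lin (complex.Re c) (complex.Im c) f2 f1.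
Qed.

Lemma cintegral0 : cintegral mu (fun=> 0) = 0.
Proof. by rewrite /cintegral /Rintegral /= !integral0. Qed.

Lemma cintegral_sum I (r : seq I) (F : I -> T -> R[i]) :
  (forall i, cintegrable (F i)) ->
  cintegral mu (fun x => \sum_(i <- r) F i x) = \sum_(i <- r) cintegral mu (F i).
Proof.
move=> IF; elim: r => [|i r IH].
  by under eq_fun do rewrite big_nil; rewrite big_nil cintegral0.
under eq_fun do rewrite big_cons.
by rewrite big_cons cintegralD ?IH//; exact: cintegrable_sum.
Qed.

Lemma cintegralJ f : cintegrable f ->
  cintegral mu (fun x => (f x)^*%C) = (cintegral mu f)^*%C.
Proof.
move=> [f1 f2]; apply: eqc_ReIm; rewrite ?ReJ ?ImJ /=.
- by under eq_Rintegral do rewrite ReJ.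
- under eq_Rintegral do rewrite ImJ -mulN1r.
  by rewrite RintegralZl// mulN1r.
Qed.

Lemma integrable_normc_sqr f : sq_integrable mu f ->
  mu.-integrable [set: T] (EFin \o (fun x => normc (f x) ^+ 2)).
Proof.
move=> [mf If]; apply/integrableP; split; first exact: measurable_normc_sqr.
by under eq_integral do rewrite gee0_abs ?lee_fin ?sqr_ge0//.
Qed.

(** The sum of the two squared moduli dominates the product, and with it the real and imaginary
    parts. *)
Lemma cintegrable_mulJ f g : sq_integrable mu f -> sq_integrable mu g ->
  cintegrable (fun x => f x * (g x)^*%C).
Proof.
move=> If Ig.
have Ifg : mu.-integrable [set: T]
    (EFin \o (fun x => 1 * normc (f x) ^+ 2 + 1 * normc (g x) ^+ 2)).
  by have [] := integrable_lin 1 1 (integrable_normc_sqr If) (integrable_normc_sqr Ig).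
have [m1 m2] : cmeasurable (fun x => f x * (g x)^*%C).
  by apply: cmeasurableM; [case: If|apply: cmeasurableJ; case: Ig].
have bnd x : normc (f x * (g x)^*%C) <= 1 * normc (f x) ^+ 2 + 1 * normc (g x) ^+ 2.
  rewrite normcM normcJ; have := sqr_ge0 (normc (f x) - normc (g x)).
  by have := mulr_ge0 (normc_ge0 (f x)) (normc_ge0 (g x)); nra.
split; apply: le_integrable Ifg => //.
- exact/measurable_EFinP.
- move=> x _ /=; rewrite lee_fin; apply: le_trans (normcRe_le _) _.
  exact: le_trans (bnd x) (ler_norm _).
- exact/measurable_EFinP.
- move=> x _ /=; rewrite lee_fin; apply: le_trans (normcIm_le _) _.
  exact: le_trans (bnd x) (ler_norm _).
Qed.

(** [L2dot] is computed on the representatives picked by [repr], which agree almost everywhere with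
    [f] and [g]. *)
Lemma L2dot_toL2 f g : sq_integrable mu f -> sq_integrable mu g ->
  L2dot (toL2 mu f) (toL2 mu g) = cintegral mu (fun x => f x * (g x)^*%C).
Proof.
move=> If Ig; have fE := toL2E If; have gE := toL2E Ig.
have [m1 m2] : cmeasurable (fun x => f x * (g x)^*%C).
  by apply: cmeasurableM; [case: If|apply: cmeasurableJ; case: Ig].
have [n1 n2] : cmeasurable (fun x => (repr (toL2 mu f) x : R[i]) *
    (repr (toL2 mu g) x : R[i])^*%C).
  have [mf _] := L2funP (repr (toL2 mu f)).
  have [mg _] := L2funP (repr (toL2 mu g)).
  by apply: cmeasurableM => //; exact: cmeasurableJ.
apply: eqc_ReIm; congr fine; apply: ae_eq_integral => //;
  try exact/measurable_EFinP; by move: fE gE; apply: filterS2 => x -> ->.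
Qed.

Lemma L2dotDl (a : R) (u v w : L2 mu) :
  L2dot (a *: u + v) w = a%:C * L2dot u w + L2dot v w.
Proof.
have [f If ->] := toL2_ex u; have [g Ig ->] := toL2_ex v.
have [h Ih ->] := toL2_ex w.
have Iaf := sq_integrableM a%:C If.
rewrite -toL2Z// -toL2D// !L2dot_toL2//; last exact: sq_integrableD.
under [in LHS]eq_fun do rewrite mulrDl -mulrA.
rewrite cintegralD ?cintegralM//; first exact: cintegrable_mulJ.
- by apply: cintegrableM; exact: cintegrable_mulJ.
- exact: cintegrable_mulJ.
Qed.

Lemma L2dotC (u v : L2 mu) : L2dot v u = (L2dot u v)^*%C.
Proof.
have [f If ->] := toL2_ex u; have [g Ig ->] := toL2_ex v.
rewrite !L2dot_toL2// -cintegralJ; last exact: cintegrable_mulJ.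
by congr cintegral; apply/funext => x; rewrite rmorphM/= conjcK mulrC.
Qed.

Lemma L2dot_norm (u : L2 mu) : L2dot u u = (`|u| ^+ 2)%:C.
Proof.
have [f If ->] := toL2_ex u; rewrite L2dot_toL2//.
apply: eqc_ReIm => /=.
  under eq_Rintegral do rewrite mulJE /= -!expr2 -normc_sqr.
  by apply: EFin_inj; rewrite sqr_norm_toL2// fineK// integrable_fin_num//; exact: integrable_normc_sqr.
under eq_Rintegral do rewrite mulJE /= mulrC subrr.
by rewrite /Rintegral integral0.
Qed.

Lemma L2dotDr (u v w : L2 mu) : L2dot u (v + w) = L2dot u v + L2dot u w.
Proof.
rewrite L2dotC (L2dotC v u) (L2dotC w u) -rmorphD; congr (_^*)%C.
by rewrite -[v in LHS]scale1r L2dotDl mul1r.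
Qed.

(** Polarization: an additive map that preserves norms preserves the real part of the scalar
    product. *)
Lemma Re_L2dot (u v : L2 mu) : complex.Re (L2dot u v) =
  (`|u + v| ^+ 2 - `|u| ^+ 2 - `|v| ^+ 2) / 2.
Proof.
have : L2dot (u + v) (u + v) = L2dot u u + L2dot u v + (L2dot u v)^*%C + L2dot v v.
  have dl w : L2dot (u + v) w = L2dot u w + L2dot v w.
    by rewrite -[u in LHS]scale1r L2dotDl mul1r.
  by rewrite L2dotDr !dl (L2dotC u v); ring.
rewrite !L2dot_norm => /(congr1 (@complex.Re R)); rewrite !ReD ReJ /= => ->.
by field.
Qed.

Lemma cintegral_gram (I J : finType) (c : I -> R[i]) (F : I -> T -> R[i])
    (c' : J -> R[i]) (F' : J -> T -> R[i]) :
  (forall i, sq_integrable mu (F i)) -> (forall i, sq_integrable mu (F' i)) ->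
  L2dot (toL2 mu (fun x => \sum_i c i * F i x)) (toL2 mu (fun x => \sum_i c' i * F' i x)) =
  \sum_i \sum_k c i * (c' k)^*%C * cintegral mu (fun x => F i x * (F' k x)^*%C).
Proof.
move=> IF IF'.
rewrite L2dot_toL2; [|by apply: sq_integrable_sum => i _; exact: sq_integrableM ..].
under eq_fun do rewrite rmorph_sum mulr_suml/=.
have Iik i k : cintegrable (fun x => c i * (c' k)^*%C * (F i x * (F' k x)^*%C)).
  by apply: cintegrableM; exact: cintegrable_mulJ.
under eq_fun => x.
  under eq_bigr do rewrite mulr_sumr.
  under eq_bigr do under eq_bigr do rewrite rmorphM/= mulrACA.
  over.
rewrite cintegral_sum => [|i]; last exact: cintegrable_sum.
apply: eq_bigr => i _; rewrite cintegral_sum//; apply: eq_bigr => k _.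
by rewrite cintegralM//; exact: cintegrable_mulJ.
Qed.

End scalar_product.

(** * Completeness of L2 and density of simple functions *)

Lemma sqr_norm_cvg (R : realType) (V : normedModType R) (u_ : nat -> V) (l : V) :
  (fun n => `|u_ n - l| ^+ 2) @ \oo --> 0 -> u_ @ \oo --> l.
Proof.
move=> h; apply/cvgrPdist_lt => e e0.
have e20 : 0 < e ^+ 2 by rewrite exprn_gt0.
move/cvgrPdist_lt : h => /(_ _ e20); apply: filterS => n.
rewrite sub0r normrN ger0_norm ?sqr_ge0// distrC.
by rewrite ltr_pXn2r// nnegrE// ltW.
Qed.

Lemma cauchy_normP (R : realType) (V : normedModType R) (u_ : nat -> V) :
  cauchy (u_ @ \oo) <-> forall e : R, 0 < e ->
  exists N, forall m n, (N <= m)%N -> (N <= n)%N -> `|u_ m - u_ n| < e.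
Proof.
rewrite -cauchy_ballP; split => [h e e0|h e e0].
- have [[A B] [[N1 _ h1] [N2 _ h2]] AB] := h e e0.
  exists (maxn N1 N2) => m n; rewrite !geq_max => /andP[m1 m2] /andP[n1 n2].
  have := AB (u_ m, u_ n); rewrite /= -ball_normE /=; apply.
  by split; [exact: h1|exact: h2].
- have [N hN] := h e e0.
  exists ([set u_ n | n in [set n | (N <= n)%N]], [set u_ n | n in [set n | (N <= n)%N]]).
    by split; exists N => // n Nn; exists n.
  move=> [_ _] [[m /= Nm <-] [n /= Nn <-]].
  by rewrite -ball_normE /=; exact: hN.
Qed.

Section completeness.
Context d (T : measurableType d) (R : realType).
Variable mu : {measure set T -> \bar R}.
Implicit Types f g : T -> R[i].

(** Telescoping turns the sequence into a series dominated by a convergent geometric one. *)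
Let is_cvg_geometric_increments (a : nat -> R) (C : R) :
  (forall k, `|a k.+1 - a k| <= C * 2^-1 ^+ k) -> cvgn a.
Proof.
move=> ha; have -> : a = (fun n => a 0%N + series (telescope a) n).
  by apply/funext => n; rewrite -eq_sum_telescope.
apply: is_cvgD; first exact: is_cvg_cst.
apply: normed_cvg; apply: (@series_le_cvg _ _ (geometric C 2^-1)) => //.
- by move=> n /=.
- by move=> n /=; exact: le_trans (normr_ge0 _) (ha n).
- by apply: is_cvg_geometric_series; rewrite ger0_norm ?invr_ge0// invf_lt1// ltr1n.
Qed.

Let limn_einf_le (u : nat -> \bar R) (b : \bar R) :
  (forall n, u n <= b)%E -> (limn_einf u <= b)%E.
Proof.
move=> ub; rewrite limn_einf_lim; apply: lime_le; first exact: is_cvg_einfs.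
apply: nearW => n; apply: le_trans (ub n).
by apply: ereal_inf_lbound; exists n => /=.
Qed.

(* The weights 4^k make the squared increments summable almost everywhere even
   after multiplication, whence geometric decay of the increments. *)
Lemma L2_fast_cvg (f_ : nat -> T -> R[i]) :
  let e k := (4 ^+ k * 2 ^+ k.+1)^-1 : R in
  (forall k, sq_integrable mu (f_ k)) ->
  (forall k m, (k <= m)%N -> `|toL2 mu (f_ m) - toL2 mu (f_ k)| ^+ 2 <= e k) ->
  exists2 f, sq_integrable mu f &
    forall k, `|toL2 mu f - toL2 mu (f_ k)| ^+ 2 <= e k.
Proof.
move=> e If fe.
have int_e k m : (k <= m)%N ->
    (\int[mu]_x (normc (f_ m x - f_ k x) ^+ 2)%:E <= (e k)%:E)%E.
  move=> km; rewrite -sqr_norm_toL2; last exact: sq_integrableB.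
  by rewrite lee_fin toL2B//; exact: fe.
pose h k x := (4 ^+ k * normc (f_ k.+1 x - f_ k x) ^+ 2)%:E.
have h0 k x : (0 <= h k x)%E by rewrite lee_fin mulr_ge0 ?sqr_ge0// exprn_ge0.
have mB k m : cmeasurable (fun x => f_ m x - f_ k x).
  by apply: cmeasurableB; [case: (If m)|case: (If k)].
have mh k : measurable_fun [set: T] (h k).
  apply/measurable_EFinP; apply: measurable_funM; first exact: measurable_cst.
  exact/measurable_funX/measurable_normc.
pose H x := (\sum_(0 <= k <oo) h k x)%E.
have mH : measurable_fun [set: T] H by exact: ge0_emeasurable_sum.
have H0 x : (0 <= H x)%E by exact: nneseries_ge0.
have IH : (\int[mu]_x H x <= 1)%E.
  rewrite integral_nneseries//.
  (* The weight [4 ^ k] cancels against [e k]; what remains is [2^-(k+1)], with total 1. *)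
  apply: (@le_trans _ _ (\sum_(0 <= k <oo) (1 / (2 ^ k.+1)%:R)%:E)%E); last first.
    exact: (@epsilon_trick0 R 1 xpredT ler01).
  apply: lee_nneseries => [k _ _|k _].
    by apply: integral_ge0 => x _; exact: h0.
  rewrite /h; under eq_integral do rewrite EFinM.
  rewrite ge0_integralZl_EFin ?exprn_ge0//; last 2 first.
  - by move=> x _; rewrite lee_fin sqr_ge0.
  - exact: measurable_normc_sqr.
  apply: (@le_trans _ _ ((4 ^+ k)%:E * (e k)%:E)%E).
    by rewrite lee_pmul2l ?lte_fin ?exprn_gt0// int_e.
  rewrite -EFinM lee_fin /e invfM mulrA divff ?mul1r ?div1r ?natrX//.
pose E := H @^-1` [set x | (x < +oo)%E].
have mE : measurable E.
  rewrite (_ : E = ~` (H @^-1` [set +oo%E])); last first.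
    by apply/seteqP; split => x /=; rewrite /E /= ltey => /eqP.
  by apply: measurableC; rewrite -[_ @^-1` _]setTI; apply: mH => //; exact: emeasurable_set1.
(* Cutting off outside [E] makes the sequence converge at every point, as the measurability of its
   limit requires, and changes it on a null set only. *)
pose g_ k x := \1_E x * f_ k x.
have mg k : cmeasurable (g_ k).
  by apply: cmeasurableM; [exact: cmeasurable_indic|case: (If k)].
have cvgg x : cvgn (fun k => complex.Re (g_ k x)) /\ cvgn (fun k => complex.Im (g_ k x)).
  suff [C hC] : exists C, forall k, normc (g_ k.+1 x - g_ k x) <= C * 2^-1 ^+ k.
    split; apply: (@is_cvg_geometric_increments _ C) => k.
      by rewrite -ReB; exact: le_trans (normcRe_le _) (hC k).
    by rewrite -ImB; exact: le_trans (normcIm_le _) (hC k).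
  rewrite /g_ indicE; have [xE|xE] := boolP (x \in E); last first.
    by exists 0 => k; rewrite !mul0r subrr [normc 0]normc0.
  move: xE; rewrite inE /E /= => Hx.
  (* A single term of the series is at most its sum, so the squared increment is at most
     [H x / 4 ^ k]. *)
  exists (Num.sqrt (fine (H x))) => k; rewrite !mul1r.
  rewrite -ler_sqr ?nnegrE ?normc_ge0 ?mulr_ge0 ?sqrtr_ge0 ?exprn_ge0 ?invr_ge0//.
  rewrite exprMn sqr_sqrtr ?fine_ge0//.
  rewrite -exprM mulnC exprM exprVn -natrX -[(2 ^ 2)%N]/4%N exprVn.
  rewrite ler_pdivlMr ?exprn_gt0// mulrC -lee_fin fineK ?ge0_fin_numE//.
  rewrite -/(h k x); apply: le_trans (nneseries_lim_ge k.+1 _) => //.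
  by rewrite big_nat_recr//= leeDr// sume_ge0.
pose g x := limn (fun k => complex.Re (g_ k x)) +i* limn (fun k => complex.Im (g_ k x)).
have mgl : cmeasurable g.
  split.
  - apply: (@measurable_fun_cvg _ _ _ _ (fun k x => complex.Re (g_ k x))).
      by move=> m; case: (mg m).
    by move=> x _; case: (cvgg x).
  - apply: (@measurable_fun_cvg _ _ _ _ (fun k x => complex.Im (g_ k x))).
      by move=> m; case: (mg m).
    by move=> x _; case: (cvgg x).
have aeE : {ae mu, forall x, E x}.
  have /(integrable_ae measurableT) : mu.-integrable [set: T] H.
    apply/integrableP; split => //.
    under eq_integral do rewrite gee0_abs//.
    exact: le_lt_trans IH (ltry _).
  by apply: filterS => x /(_ Logic.I); rewrite ge0_fin_numE.
have int_g k : (\int[mu]_x (normc (g x - f_ k x) ^+ 2)%:E <= (e k)%:E)%E.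
  rewrite (_ : (\int[mu]_x _ = \int[mu]_x (normc (g x - g_ k x) ^+ 2)%:E)%E); last first.
    apply: ae_eq_integral => //.
    - by apply: measurable_normc_sqr; apply: cmeasurableB => //; case: (If k).
    - by apply: measurable_normc_sqr; exact: cmeasurableB.
    - move: aeE; apply: filterS => x Ex _.
      by rewrite /g_ indicE mem_set// mul1r.
  (* Fatou's lemma in [m] with [k] fixed: the bound [e k] holds for all later indices, hence for the
     limit. *)
  pose F m x := (normc (g_ (m + k)%N x - g_ k x) ^+ 2)%:E.
  have cvgF x : F ^~ x @ \oo --> (normc (g x - g_ k x) ^+ 2)%:E.
    have [c1 c2] := cvgg x.
    apply: cvg_EFin; first exact: nearW.
    rewrite normc_sqr !(ReB, ImB).
    rewrite (_ : fine \o _ = fun m => (complex.Re (g_ (m + k)%N x) - complex.Re (g_ k x)) ^+ 2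
      + (complex.Im (g_ (m + k)%N x) - complex.Im (g_ k x)) ^+ 2); last first.
      by apply/funext => m /=; rewrite normc_sqr !(ReB, ImB).
    apply: cvgD; rewrite expr2; under eq_fun do rewrite expr2.
    - apply: cvgM; apply: cvgB; try exact: cvg_cst;
        exact: (@cvg_comp _ _ _ (fun m => (m + k)%N) _ _ _ _ (cvg_addnr k) c1).
    - apply: cvgM; apply: cvgB; try exact: cvg_cst;
        exact: (@cvg_comp _ _ _ (fun m => (m + k)%N) _ _ _ _ (cvg_addnr k) c2).
  have mF m : measurable_fun [set: T] (F m).
    by apply: measurable_normc_sqr; exact: cmeasurableB.
  under eq_integral => x _ do rewrite -(cvg_limn_einf_sup (cvgF x)).1.
  apply: le_trans (fatou mu measurableT mF _) _.
    by move=> m x _; rewrite lee_fin sqr_ge0.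
  apply: limn_einf_le => m; apply: le_trans (int_e k (m + k)%N (leq_addl _ _)).
  apply: ge0_le_integral => //.
  - by move=> x _; rewrite lee_fin sqr_ge0.
  - exact: measurable_normc_sqr.
  - move=> x _; rewrite lee_fin /F /g_ -mulrBr indicE.
    by case: (x \in E); rewrite ?mul1r// mul0r [normc 0]normc0 expr0n sqr_ge0.
have Igf k : sq_integrable mu (fun x => g x - f_ k x).
  split; first by apply: cmeasurableB => //; case: (If k).
  exact: le_lt_trans (int_g k) (ltry _).
have Ig : sq_integrable mu g.
  rewrite (_ : g = fun x => (g x - f_ 0%N x) + f_ 0%N x); first exact: sq_integrableD.
  by apply/funext => x; rewrite subrK.
exists g => // k; rewrite -toL2B// -lee_fin sqr_norm_toL2//.
Qed.

Lemma L2_complete (u_ : nat -> L2 mu) : cauchy (u_ @ \oo) -> exists l : L2 mu, u_ @ \oo --> l.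
Proof.
move/cauchy_normP => cu.
pose e k := (4 ^+ k * 2 ^+ k.+1)^-1 : R.
have e0 k : 0 < e k by rewrite invr_gt0 mulr_gt0// exprn_gt0.
have /choice[N hN] : forall k, exists N, forall m n, (N <= m)%N -> (N <= n)%N ->
    `|u_ m - u_ n| ^+ 2 <= e k.
  move=> k; have [|N hN] := cu (Num.sqrt (e k)); first by rewrite sqrtr_gt0.
  exists N => m n Nm Nn; rewrite -[e k]sqr_sqrtr ?(ltW (e0 k))//.
  by rewrite lerXn2r ?nnegrE ?sqrtr_ge0// ltW// hN.
(* The maximum makes [phi m] late enough for every threshold [N k] with [k <= m], so the subsequence
   meets the rate of [L2_fast_cvg]. *)
pose phi k := (\max_(i < k.+1) N i)%N.
have Nphi k m : (k <= m)%N -> (N k <= phi m)%N.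
  move=> km; have km' : (k < m.+1)%N by [].
  exact: (@leq_bigmax _ (fun i : 'I_m.+1 => N i) (Ordinal km')).
have [||f If fe] := @L2_fast_cvg (fun k => repr (u_ (phi k))).
- by move=> k; exact: L2funP.
- by move=> k m km; rewrite !toL2_repr; apply: hN; exact: Nphi.
exists (toL2 mu f); apply/cvgrPdist_lt => eps eps0.
have [k ke] : exists k, e k < (eps / 2) ^+ 2.
  have : 0 < (eps / 2) ^+ 2 by rewrite exprn_gt0// divr_gt0.
  set a := _ ^+ 2 => a0; exists (Num.bound a^-1).
  rewrite /e -[ltRHS]invrK ltf_pV2 ?posrE ?invr_gt0 ?a0//.
  apply: (@lt_le_trans _ _ (Num.bound a^-1)%:R).
    by apply: archi_boundP; rewrite invr_ge0 ltW.
  set b := Num.bound _; apply: (@le_trans _ _ (2 ^+ b.+1)).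
    by rewrite -natrX ler_nat (leq_trans (ltnW (ltn_expl b (isT : 1 < 2)%N)))// leq_exp2l.
  by apply: ler_peMl; [rewrite exprn_ge0|rewrite exprn_ege1// ler1n].
have sqrt_lt (x : R) : 0 <= x -> x ^+ 2 <= e k -> x < eps / 2.
  move=> x0 xe; have := le_lt_trans xe ke.
  by rewrite ltr_pXn2r// nnegrE// divr_ge0// ltW.
exists (phi k) => // n /= kn.
rewrite (_ : _ - _ = (toL2 mu f - u_ (phi k)) + (u_ (phi k) - u_ n)); last first.
  by rewrite addrA subrK.
rewrite (le_lt_trans (ler_normD _ _))// [ltRHS]splitr ltrD//; apply: sqrt_lt => //.
- by have := fe k; rewrite toL2_repr.
- by apply: hN; [exact: Nphi|apply: leq_trans kn; exact: Nphi].
Qed.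

End completeness.

(** * Dominated convergence in L2 and density of simple functions *)

Section approximation.
Import HBSimple.
Context d (T : measurableType d) (R : realType).
Variable mu : {measure set T -> \bar R}.
Implicit Types f g : T -> R[i].

Lemma L2_dominated_cvg (f_ : nat -> T -> R[i]) f (g : T -> R) :
  (forall n, sq_integrable mu (f_ n)) -> sq_integrable mu f ->
  mu.-integrable [set: T] (EFin \o (fun x => g x ^+ 2)) ->
  (forall n x, normc (f_ n x - f x) <= g x) ->
  (forall x, (fun n => normc (f_ n x - f x)) @ \oo --> 0) ->
  (fun n => toL2 mu (f_ n)) @ \oo --> toL2 mu f.
Proof.
move=> If_ If Ig fg cf; apply: sqr_norm_cvg.
pose h n x := (normc (f_ n x - f x) ^+ 2)%:E.
have mB n : cmeasurable (fun x => f_ n x - f x).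
  by apply: cmeasurableB; [case: (If_ n)|case: If].
have [||||_ _] := @dominated_convergence _ _ _ mu _ measurableT h (cst 0%E) _ _ _ _ Ig.
- by move=> n; exact: measurable_normc_sqr.
- exact: measurable_cst.
- apply: nearW => x _; apply: cvg_EFin; first exact: nearW.
  rewrite (_ : fine \o _ = fun n => normc (f_ n x - f x) * normc (f_ n x - f x)) //.
  by rewrite -[X in _ --> X](mulr0 0); exact: cvgM.
- apply: nearW => x n _; rewrite gee0_abs ?lee_fin ?sqr_ge0//.
  by rewrite lerXn2r ?nnegrE ?normc_ge0// (le_trans _ (fg n x))// normc_ge0.
rewrite integral0 => /fine_cvg; apply: cvg_trans; apply: near_eq_cvg.
apply: nearW => n /=; rewrite -toL2B// /h -sqr_norm_toL2//.
exact: sq_integrableB.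
Qed.

Lemma cvg_cplx_dist (u_ : nat -> R[i]) (z : R[i]) :
  (fun n => complex.Re (u_ n)) @ \oo --> complex.Re z ->
  (fun n => complex.Im (u_ n)) @ \oo --> complex.Im z ->
  (fun n => normc (u_ n - z)) @ \oo --> 0.
Proof.
move=> hr hi; apply: (@squeeze_cvgr _ _ _ _ (cst 0)
    (fun n => `|complex.Re (u_ n) - complex.Re z| + `|complex.Im (u_ n) - complex.Im z|)).
- by apply: nearW => n; rewrite normc_ge0/= -ReB -ImB normc_le_ReIm.
- exact: cvg_cst.
- rewrite -[X in _ --> X](addr0 0); apply: cvgD; rewrite -[X in _ --> X](@normr0 _ R).
    by apply: cvg_norm; rewrite -(subrr (complex.Re z)); apply: cvgB => //; exact: cvg_cst.
  by apply: cvg_norm; rewrite -(subrr (complex.Im z)); apply: cvgB => //; exact: cvg_cst.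
Qed.

(** The sets are the level sets of [g]; duplicates are removed from the enumeration of its range, so
    that distinct indices carry distinct values. *)
Lemma finite_range_simple (g : T -> R[i]) : cmeasurable g -> finite_set (range g) ->
  exists n (c : 'I_n -> R[i]) (A : 'I_n -> set T),
    [/\ forall s, measurable (A s), trivIset [set: 'I_n] A &
        forall x, g x = \sum_s c s * \1_(A s) x].
Proof.
move=> [mr mi] /finite_seqP[s0 rs0]; pose s := undup s0.
exists (size s), (fun k => s`_k), (fun k => g @^-1` [set s`_k]); split.
- move=> k; rewrite (_ : _ @^-1` _ =
    ((fun x => complex.Re (g x)) @^-1` [set complex.Re s`_k]) `&`
    ((fun x => complex.Im (g x)) @^-1` [set complex.Im s`_k])); last first.
    apply/seteqP; split => x /= => [->//|[a b]]; exact: eqc_ReIm.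
  by apply: measurableI; rewrite -[X in measurable X]setTI; [apply: mr|apply: mi].
- move=> k l _ _ [x [/= gk gl]]; apply/val_inj/eqP => /=.
  by rewrite -(nth_uniq 0 (ltn_ord k) (ltn_ord l) (undup_uniq s0)) -gk gl.
- move=> x; have gs : g x \in s.
    have : range g (g x) by exists x.
    by rewrite rs0 /= mem_undup.
  have gsi : (index (g x) s < size s)%N by rewrite index_mem.
  rewrite (bigD1 (Ordinal gsi))//= big1 => [|k kg].
    by rewrite nth_index// addr0 indicE mem_set ?mulr1//= nth_index.
  rewrite indicE memNset ?mulr0//= => gk; move/negP : kg; apply.
  by apply/eqP/val_inj; rewrite /= gk index_uniq// undup_uniq.
Qed.

Lemma simple_dense (u : L2 mu) (e : R) : 0 < e ->
  exists n (c : 'I_n -> R[i]) (A : 'I_n -> set T),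
    [/\ forall s, measurable (A s), trivIset [set: 'I_n] A,
        sq_integrable mu (fun x => \sum_s c s * \1_(A s) x) &
        `|u - toL2 mu (fun x => \sum_s c s * \1_(A s) x)| < e].
Proof.
move=> e0; have [f If ->] := toL2_ex u.
have [[mr mi] _] := If.
have [r_ hr] := approximation_sfun measurableT (proj2 (measurable_EFinP _ _) mr).
have [i_ hi] := approximation_sfun measurableT (proj2 (measurable_EFinP _ _) mi).
pose s n (x : T) := r_ n x +i* i_ n x.
have cs x : (fun n => normc (s n x - f x)) @ \oo --> 0.
  apply: cvg_cplx_dist.
    by have /fine_cvg := hr x Logic.I.
  by have /fine_cvg := hi x Logic.I.
have ms n : cmeasurable (s n) by split; exact: measurable_funPT.
(* Off [B n] the approximation is replaced by 0, whose error is [|f|]; thus [|f|] dominates every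
   error. Where [f x] is nonzero, [x] lies in [B n] for all large [n]; where it vanishes, so does
   [t n x]. *)
pose B n := [set x | normc (s n x - f x) <= normc (f x)].
have mB n : measurable (B n).
  rewrite -[B n]setTI; apply: measurable_fun_le => //; apply: measurable_normc => //.
  exact: cmeasurableB.
pose t n x := \1_(B n) x * s n x.
have mt n : cmeasurable (t n) by apply: cmeasurableM => //; exact: cmeasurable_indic.
have tf n x : normc (t n x - f x) <= normc (f x).
  rewrite /t indicE; have [xB|_] := boolP (x \in B n).
    by rewrite mul1r; move: xB; rewrite inE.
  by rewrite mul0r sub0r [normc _](@normcN R (f x)).
have It n : sq_integrable mu (t n).
  apply: (@sq_integrable_le _ _ _ mu _ f 2 (mt n) If) => x.
  rewrite -[t n x](subrK (f x)) (le_trans (ler_normcD _ _))//.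
  by rewrite mulr_natl mulr2n lerD2r.
have fint n : finite_set (range (t n)).
  apply: (@sub_finite_set _ _ ([set 0] `|`
     (fun p : R * R => p.1 +i* p.2) @` (range (r_ n) `*` range (i_ n)))).
    move=> _ [x _ <-]; rewrite /t indicE; case: (x \in B n).
      by right; exists (r_ n x, i_ n x); rewrite ?mul1r//; split; exists x.
    by left; rewrite mul0r.
  rewrite finite_setU; split; first exact: finite_set1.
  by apply: finite_image; apply: finite_setX; exact: fimfunP.
have : (fun n => toL2 mu (t n)) @ \oo --> toL2 mu f.
  apply: (@L2_dominated_cvg _ _ (fun x => normc (f x))) => //.
    exact: integrable_normc_sqr.
  move=> x; have [f0|f0] := eqVneq (f x) 0.
    rewrite (_ : (fun n => _) = cst 0); first exact: cvg_cst.
    apply/funext => n; apply/eqP; rewrite eq_le normc_ge0 andbT.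
    by rewrite (le_trans (tf n x))// f0 [normc 0]normc0.
  apply: cvg_trans (cs x); apply: near_eq_cvg.
  have fx0 : 0 < normc (f x).
    by rewrite lt_neqAle normc_ge0 andbT eq_sym; apply: contra f0 => /eqP/eq0_normc ->.
  have /cvgrPdist_lt /(_ _ fx0) := cs x; apply: filterS => n.
  rewrite sub0r normrN ger0_norm ?normc_ge0// => nf.
  by rewrite /t indicE mem_set ?mul1r// /B /= ltW.
move/cvgrPdist_lt => /(_ _ e0)[n _ /(_ n (leqnn n))] /= tn.
have [m [c [A [mA tA tE]]]] := finite_range_simple (mt n) (fint n).
have tE' : (fun x => \sum_s c s * \1_(A s) x) = t n by apply/funext => x; rewrite tE.
by exists m, c, A; split; rewrite ?tE'.
Qed.

End approximation.

(** * The random integral as an isometry *)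

Lemma invS_small (R : realType) (e : R) : 0 < e ->
  exists N, forall n, (N <= n)%N -> n.+1%:R^-1 < e.
Proof.
move=> e0; exists (Num.bound e^-1) => n Nn.
rewrite invf_plt ?posrE// (@lt_le_trans _ _ (Num.bound e^-1)%:R)//.
  by apply: archi_boundP; rewrite invr_ge0 ltW.
by rewrite ler_nat ltnW.
Qed.

Section isometric_extension.
Variables (R : realType) (V W : normedModType R).

Lemma le_eps_eq (x y : W) : (forall e : R, 0 < e -> `|x - y| <= e) -> x = y.
Proof.
move=> h; apply/eqP; rewrite -subr_eq0 -normr_le0.
by apply/ler_addgt0Pr => e e0; rewrite add0r; exact: h.
Qed.

(* The closure of the graph of a densely defined linear isometry is the graph
   of its extension. *)
Lemma isometric_extension (Gr : V -> W -> Prop) :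
  (forall (a : R) u X v Y, Gr u X -> Gr v Y -> Gr (a *: u + v) (a *: X + Y)) ->
  (forall u X, Gr u X -> `|X| = `|u|) ->
  (forall u (e : R), 0 < e -> exists v Y, Gr v Y /\ `|u - v| < e) ->
  (forall w_ : nat -> W, cauchy (w_ @ \oo) -> exists l : W, w_ @ \oo --> l) ->
  exists I : V -> W, [/\ forall (a : R) u v, I (a *: u + v) = a *: I u + I v,
    forall u, `|I u| = `|u| & forall u X, Gr u X -> I u = X].
Proof.
move=> Glin Giso Gdense Wc.
pose cl u X := forall e : R, 0 < e ->
  exists v Y, [/\ Gr v Y, `|u - v| < e & `|X - Y| < e].
have cl_lin (a : R) u X v Y : cl u X -> cl v Y -> cl (a *: u + v) (a *: X + Y).
  (* The added 1 keeps the divisor positive when [a = 0]. *)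
  move=> uX vY e e0; pose b := `|a| + 1.
  have b0 : 0 < b by rewrite ltr_wpDl.
  have [u' [X' [G1 h1 h2]]] := uX (e / 2 / b) (divr_gt0 (divr_gt0 e0 (ltr0Sn R 1)) b0).
  have [v' [Y' [G2 k1 k2]]] := vY (e / 2) (divr_gt0 e0 (ltr0Sn R 1)).
  have aux (U : normedModType R) (x x' y y' : U) : `|x - x'| < e / 2 / b ->
      `|y - y'| < e / 2 -> `|a *: x + y - (a *: x' + y')| < e.
    move=> hx hy; rewrite opprD addrACA -scalerBr (le_lt_trans (ler_normD _ _))//.
    rewrite [ltRHS]splitr ler_ltD// normrZ.
    rewrite (@le_trans _ _ (b * `|x - x'|))// ?ler_wpM2r ?lerDl//.
    by rewrite mulrC -ler_pdivlMr// ltW.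
  by exists (a *: u' + v'), (a *: X' + Y'); split; [exact: Glin|exact: aux|exact: aux].
have cl_iso u X : cl u X -> `|X| = `|u|.
  move=> uX; apply/eqP; rewrite -subr_eq0 -normr_le0.
  apply/ler_addgt0Pr => e e0; rewrite add0r.
  have [v [Y [GvY h1 h2]]] := uX (e / 2) (divr_gt0 e0 (ltr0Sn R 1)).
  rewrite (_ : _ - _ = (`|X| - `|Y|) + (`|v| - `|u|)); last first.
    by rewrite (Giso _ _ GvY) addrA subrK.
  rewrite (le_trans (ler_normD _ _))// [leRHS]splitr lerD// ltW//.
    exact: le_lt_trans (ler_dist_dist _ _) h2.
  by rewrite distrC; exact: le_lt_trans (ler_dist_dist _ _) h1.
have cl_uniq u X Y : cl u X -> cl u Y -> X = Y.
  (* By linearity [Y - X] lies over [u - u = 0], so its norm is 0. *)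
  move=> uX uY; have := cl_iso _ _ (cl_lin (-1) _ _ _ _ uX uY).
  rewrite !scaleN1r addNr normr0 => /normr0_eq0 /eqP.
  by rewrite addrC subr_eq0 => /eqP.
(* Approximants of [u] form a Cauchy sequence; by isometry so do their partners in [W], whose limit
   is the value at [u]. *)
have cl_ex u : exists X, cl u X.
  have /choice[s hs] : forall n, exists p : V * W, Gr p.1 p.2 /\ `|u - p.1| < n.+1%:R^-1.
    by move=> n; have [|v [Y [GvY h]]] := Gdense u (n.+1%:R^-1); [|exists (v, Y)].
  have [|X hX] := Wc (fun n => (s n).2).
    apply/cauchy_normP => e e0; have [N hN] := invS_small (divr_gt0 e0 (ltr0Sn R 1)).
    exists N => m n Nm Nn.
    have /Giso : Gr (-1 *: (s n).1 + (s m).1) (-1 *: (s n).2 + (s m).2).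
      by apply: Glin; [case: (hs n)|case: (hs m)].
    rewrite !scaleN1r ![- _ + _]addrC => ->.
    rewrite (_ : _ - _ = (u - (s n).1) - (u - (s m).1)); last first.
      by rewrite opprB [RHS]addrC addrA subrK.
    rewrite (le_lt_trans (ler_normB _ _))// [ltRHS]splitr ltrD//.
      by apply: lt_trans (hs n).2 _; exact: hN.
    by apply: lt_trans (hs m).2 _; exact: hN.
  exists X => e e0; have [N hN] := invS_small e0.
  move/cvgrPdist_lt : hX => /(_ _ e0)[M _ hM].
  exists (s (maxn N M)).1, (s (maxn N M)).2; split; first by case: (hs (maxn N M)).
    by apply: lt_trans (hs _).2 _; apply: hN; rewrite leq_maxl.
  by apply: hM; rewrite /= leq_maxr.
have /choice[I hI] := cl_ex.
exists I; split.
- by move=> a u v; apply: cl_uniq (hI _) _; exact: cl_lin.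
- by move=> u; exact: cl_iso.
- move=> u X uX; apply: cl_uniq (hI u) _ => e e0.
  by exists u, X; rewrite !subrr !normr0.
Qed.

End isometric_extension.

(** * Multiplication by the imaginary unit on L2 *)

Section multiplication_by_i.
Context d (T : measurableType d) (R : realType).
Variable mu : {measure set T -> \bar R}.

(** Scalars of [L2] are real, so the complex structure is supplied as an operator. *)
Definition L2mulI (u : L2 mu) : L2 mu := toL2 mu (fun x => 'i%C * (repr u x : R[i])).

Lemma L2mulI_toL2 (f : T -> R[i]) : sq_integrable mu f ->
  L2mulI (toL2 mu f) = toL2 mu (fun x => 'i%C * f x).
Proof.
move=> If; apply: eq_toL2.
- by apply: sq_integrableM; exact: L2funP.
- exact: sq_integrableM.
- by have := toL2E If; apply: filterS => x ->.
Qed.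

Lemma L2mulIB u v : L2mulI u - L2mulI v = L2mulI (u - v).
Proof.
have [f If ->] := toL2_ex u; have [g Ig ->] := toL2_ex v.
rewrite -toL2B// !L2mulI_toL2//; last exact: sq_integrableB.
rewrite -toL2B; [|exact: sq_integrableM ..].
by congr toL2; apply/funext => x; rewrite mulrBr.
Qed.

Lemma L2mulI_norm u : `|L2mulI u| = `|u|.
Proof.
have [f If ->] := toL2_ex u.
rewrite (L2mulI_toL2 If) (norm_toL2 If) (norm_toL2 (sq_integrableM 'i%C If)).
have i1 : normc 'i%C = 1 :> R by rewrite /= expr0n expr1n add0r sqrtr1.
by under eq_integral do rewrite normcM i1 mul1r.
Qed.

(** The second argument is conjugated: multiplying it by the imaginary unit multiplies the product
    by [-i], which moves the imaginary part into the real one. *)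
Lemma Im_L2dot u v : complex.Im (L2dot u v) = complex.Re (L2dot u (L2mulI v)).
Proof.
have [f If ->] := toL2_ex u; have [g Ig ->] := toL2_ex v.
rewrite L2mulI_toL2// !L2dot_toL2//; last exact: sq_integrableM.
rewrite (_ : cintegral mu (fun x => f x * ('i%C * g x)^*%C) =
  ('i%C)^*%C * cintegral mu (fun x => f x * (g x)^*%C)); last first.
  rewrite -cintegralM; last exact: cintegrable_mulJ.
  by congr cintegral; apply/funext => x; rewrite rmorphM/= mulrCA.
by rewrite [in RHS]ReM /=; ring.
Qed.

End multiplication_by_i.

(** * The finite measure [G j j] and its indicators *)

Section diag_measure.
Variables (R : realType) (nu d : nat) (G : spectral_measure R nu d) (j : 'I_d).
Local Notation mu := (diag_measure G j).

Lemma diag_measure_fin : (mu [set: torus R nu] < +oo)%E.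
Proof.
rewrite /diag_measure /= /measure_of_charge /crestr0 mem_set//= /crestr setIT.
by rewrite ltey_eq fin_num_measure.
Qed.

(** Counterpart of [rsm_covariance]: together they equate the two Gram matrices from which the
    isometry arises. *)
Lemma cintegral_indic (A B : set (torus R nu)) : measurable A -> measurable B ->
  cintegral mu (fun x => \1_A x * (\1_B x)^*%C) = G j j (A `&` B).
Proof.
move=> mA mB; have mAB : measurable (A `&` B) by exact: measurableI.
rewrite diag_measureE// (_ : (fun x => _) = (fun x => (\1_(A `&` B) x : R)%:C)); last first.
  by apply/funext => x; rewrite conjc_nat -natrM mulnb indicE in_setI; case: (_ && _).
apply: eqc_ReIm => /=; last by rewrite /Rintegral integral0.
by rewrite /Rintegral /= integral_indic// setIT.
Qed.

Lemma sq_integrable_simple n (c : 'I_n -> R[i]) (A : 'I_n -> set (torus R nu)) :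
  (forall s, measurable (A s)) -> sq_integrable mu (fun x => \sum_s c s * \1_(A s) x).
Proof.
move=> mA; apply: sq_integrable_sum => s _; apply: sq_integrableM.
apply: (@sq_integrable_bounded _ _ _ _ _ 1); first exact: diag_measure_fin.
  exact: cmeasurable_indic.
by move=> x; rewrite indicE; case: (_ \in _); rewrite ?[normc 1]normc1 ?[normc 0]normc0.
Qed.

End diag_measure.

(** * Existence, isometry and complex structure of the random integral *)

Section random_integral.
Variables (R : realType) (nu d : nat) (G : spectral_measure R nu d).
Variables (dO : measure_display) (Omega : measurableType dO).
Variables (P : probability Omega R) (Z : random_spectral_measure G P) (j : 'I_d).
Local Notation mu := (diag_measure G j).

(** A relation, because a simple function has many representations; that all of them give the same
    random variable follows from linearity and isometry. The sets may overlap, so that concatenating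
    two families represents a sum. *)
Definition simple_integral_graph (u : L2 mu) (X : L2 P) : Prop :=
  exists n (c : 'I_n -> R[i]) (A : 'I_n -> set (torus R nu)),
  [/\ forall s, measurable (A s), u = toL2 mu (fun x => \sum_s c s * \1_(A s) x) &
      X = toL2 P (fun w => \sum_s c s * Z j (A s) w)].

Lemma sq_integrable_rsm n (c : 'I_n -> R[i]) (A : 'I_n -> set (torus R nu)) :
  (forall s, measurable (A s)) -> sq_integrable P (fun w => \sum_s c s * Z j (A s) w).
Proof.
by move=> mA; apply: sq_integrable_sum => s _; apply: sq_integrableM; exact: rsm_sq_integrable.
Qed.

Let sum_cat (T : Type) m n (a : R) (c : 'I_m -> R[i]) (c' : 'I_n -> R[i])
    (F : set (torus R nu) -> T -> R[i]) (A : 'I_m -> set (torus R nu))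
    (A' : 'I_n -> set (torus R nu)) x :
  \sum_(s < m + n) (match fintype.split s with inl i => a%:C * c i | inr k => c' k end) *
    F (match fintype.split s with inl i => A i | inr k => A' k end) x =
  a%:C * (\sum_s c s * F (A s) x) + \sum_s c' s * F (A' s) x.
Proof.
rewrite big_split_ord mulr_sumr; congr (_ + _); apply: eq_bigr => i _.
  by rewrite -[lshift _ _]/(unsplit (inl i)) unsplitK mulrA.
by rewrite -[rshift _ _]/(unsplit (inr i)) unsplitK.
Qed.

Lemma simple_integral_graph_linear (a : R) u X v Y :
  simple_integral_graph u X -> simple_integral_graph v Y ->
  simple_integral_graph (a *: u + v) (a *: X + Y).
Proof.
move=> [m [c [A [mA -> ->]]]] [n [c' [A' [mA' -> ->]]]].
exists (m + n)%N, (fun s => match fintype.split s with inl i => a%:C * c i | inr k => c' k end),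
  (fun s => match fintype.split s with inl i => A i | inr k => A' k end).
split; first by move=> s; case: (fintype.split s).
- have If := sq_integrable_simple G j c mA; have Ig := sq_integrable_simple G j c' mA'.
  rewrite -toL2Z// -toL2D//; last exact: sq_integrableM.
  by congr toL2; apply/funext => x; rewrite (sum_cat _ _ _ (fun B x => \1_B x)).
- have If := sq_integrable_rsm c mA; have Ig := sq_integrable_rsm c' mA'.
  rewrite -toL2Z// -toL2D//; last exact: sq_integrableM.
  by congr toL2; apply/funext => x; rewrite (sum_cat _ _ _ (Z j)).
Qed.

(** Coefficients are complex, so the graph is stable under the imaginary unit; this is what later
    makes the extension commute with it. *)
Lemma simple_integral_graph_mulI u X : simple_integral_graph u X ->
  simple_integral_graph (L2mulI u) (L2mulI X).
Proof.
move=> [n [c [A [mA -> ->]]]].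
exists n, (fun s => 'i%C * c s), A; split => //.
- rewrite L2mulI_toL2; last exact: sq_integrable_simple.
  by congr toL2; apply/funext => x; rewrite mulr_sumr; under eq_bigr do rewrite mulrA.
- rewrite L2mulI_toL2; last exact: sq_integrable_rsm.
  by congr toL2; apply/funext => x; rewrite mulr_sumr; under eq_bigr do rewrite mulrA.
Qed.

(* Both squared norms are the Gram sum of [c s * (c t)^* * G j j (A s `&` A t)];
   no disjointness is needed. *)
Lemma simple_integral_graph_isometric u X : simple_integral_graph u X -> `|X| = `|u|.
Proof.
move=> [n [c [A [mA -> ->]]]].
apply/eqP; rewrite -(@eqrXn2 _ 2)//; apply/eqP/(@complexI R); rewrite -!L2dot_norm.
have I1 i : sq_integrable mu (fun x => \1_(A i) x : R[i]).
  have := sq_integrable_simple G j (fun _ : 'I_1 => 1) (fun _ => mA i).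
  by under eq_fun do rewrite big_ord1 mul1r.
have IZ i : sq_integrable P (Z j (A i)) by exact: rsm_sq_integrable.
rewrite !cintegral_gram//; apply: eq_bigr => s _; apply: eq_bigr => t _.
by rewrite cintegral_indic// rsm_covariance.
Qed.

(** The sets are kept disjoint, since [extends_simple_integral] prescribes values for disjoint
    families only. *)
Lemma simple_integral_graph_dense (u : L2 mu) (e : R) : 0 < e ->
  exists n (c : 'I_n -> R[i]) (A : 'I_n -> set (torus R nu)),
    [/\ forall s, measurable (A s), trivIset [set: 'I_n] A &
        `|u - toL2 mu (fun x => \sum_s c s * \1_(A s) x)| < e].
Proof.
by move=> e0; have [n [c [A [? ? _ ?]]]] := simple_dense u e0; exists n, c, A.
Qed.

(** The isometric extension [I] of the graph is continuous and extends the simple integral, so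
    [xget] does not fall back on its default; whichever continuous extension it picks agrees with
    [I] on a dense set, hence everywhere. *)
Lemma random_integral_extension : [/\
  forall (a : R) u v, random_integral Z j (a *: u + v) =
    a *: random_integral Z j u + random_integral Z j v,
  forall u, `|random_integral Z j u| = `|u| &
  forall u X, simple_integral_graph u X -> random_integral Z j u = X].
Proof.
have [||||I [Il Ii Ig]] := @isometric_extension R (L2 mu) (L2 P) simple_integral_graph.
- exact: simple_integral_graph_linear.
- exact: simple_integral_graph_isometric.
- move=> u e e0; have [n [c [A [mA _ h]]]] := simple_integral_graph_dense u e0.
  exists (toL2 mu (fun x => \sum_s c s * \1_(A s) x)), (toL2 P (fun w => \sum_s c s * Z j (A s) w)).
  by split => //; exists n, c, A.
- by move=> w_; exact: L2_complete.
have IB u v : I u - I v = I (u - v).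
  by rewrite [u - v]addrC -[- v]scaleN1r Il scaleN1r addrC.
suff -> : random_integral Z j = I by [].
have Ispec : [set I | continuous I /\ extends_simple_integral Z (j:=j) I] I.
  split => [u|n c A mA _]; last by apply: Ig; exists n, c, A.
  apply/(@cvgrPdist_lt _ _ _ _ (nbhs_filter u)) => e e0.
  by apply/nbhs_ballP; exists e => //= v; rewrite -ball_normE /= IB Ii.
rewrite /random_integral; case: xgetP => [I' _ [cI' eI']|/(_ I)//].
apply/funext => u; apply: le_eps_eq => e e0.
have e20 : 0 < e / 2 by rewrite divr_gt0.
have /(@cvgrPdist_lt _ _ _ _ (nbhs_filter u))/(_ _ e20) := cI' u.
move=> /nbhs_ballP[r /= r0 hr].
(* [r] serves the continuity of the chosen [I'] at [u], and [e / 2] the isometry of [I]. *)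
have [|n [c [A [mA tA h]]]] := @simple_integral_graph_dense u (Num.min r (e / 2)).
  by rewrite lt_min r0.
move: h; set v := toL2 _ _; rewrite lt_min => /andP[h1 h2].
have Iv : I' v = I v by rewrite eI'// (proj2 Ispec).
rewrite (_ : _ - _ = (I' u - I' v) + (I v - I u)); last by rewrite Iv addrA subrK.
rewrite (le_trans (ler_normD _ _))// [leRHS]splitr lerD// ltW//.
  by apply: hr; rewrite -ball_normE.
by rewrite IB Ii distrC.
Qed.

Lemma random_integralB u v : random_integral Z j u - random_integral Z j v =
  random_integral Z j (u - v).
Proof.
have [Il _ _] := random_integral_extension.
by rewrite [u - v]addrC -[- v]scaleN1r Il scaleN1r addrC.
Qed.

(** Both sides preserve distances in [u] and agree on the dense set of simple functions. *)
Lemma random_integral_mulI u : random_integral Z j (L2mulI u) = L2mulI (random_integral Z j u).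
Proof.
have [_ Ii Ig] := random_integral_extension.
apply: le_eps_eq => e e0; have e20 : 0 < e / 2 by rewrite divr_gt0.
have [n [c [A [mA _ h]]]] := simple_integral_graph_dense u e20.
have := Ig _ _ (ex_intro _ n (ex_intro _ c (ex_intro _ A (And3 mA erefl erefl)))).
move: h; set v := toL2 mu _; set Y := toL2 P _ => h IvY.
have gvY : simple_integral_graph v Y by exists n, c, A.
have IMv := Ig _ _ (simple_integral_graph_mulI gvY).
rewrite (_ : _ - _ = (random_integral Z j (L2mulI u) - random_integral Z j (L2mulI v)) +
  (L2mulI (random_integral Z j v) - L2mulI (random_integral Z j u))); last first.
  by rewrite IMv IvY addrA subrK.
rewrite (le_trans (ler_normD _ _))// [leRHS]splitr lerD// ltW//.
  by rewrite random_integralB L2mulIB Ii L2mulI_norm.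
by rewrite L2mulIB L2mulI_norm random_integralB Ii distrC.
Qed.

(** Norms determine the real part by polarization, and [Im_L2dot] turns the imaginary part into a
    real one. *)
Lemma random_integral_dot u v :
  L2dot (random_integral Z j u) (random_integral Z j v) = L2dot u v.
Proof.
have [Il Ii _] := random_integral_extension.
have Re_dot u' v' : complex.Re (L2dot (random_integral Z j u') (random_integral Z j v')) =
    complex.Re (L2dot u' v').
  rewrite !Re_L2dot !Ii (_ : _ + _ = random_integral Z j (u' + v')) ?Ii//.
  by rewrite -[u' in RHS]scale1r Il scale1r.
by apply: eqc_ReIm; rewrite ?Im_L2dot -?random_integral_mulI Re_dot.
Qed.

End random_integral.

(** * The space K1 *)

Section torus_involution.
Variables (R : realType) (nu : nat).
Local Notation torus := (torus R nu).

Lemma torus_eq (x y : torus) :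
  (forall k, tnth (torus_coord x) k = tnth (torus_coord y) k) -> x = y.
Proof. by move=> h; apply/val_inj/eq_from_tnth. Qed.

Lemma torus_oppE (x : torus) k : tnth (torus_coord (torus_opp x)) k =
  if tnth (torus_coord x) k == - pi then - pi else - tnth (torus_coord x) k.
Proof. by rewrite /torus_coord /= tnth_mktuple. Qed.

Lemma torus_coord_bounds (x : torus) k : - pi <= tnth (torus_coord x) k < pi.
Proof. by have /forallP/(_ k) := svalP x. Qed.

Lemma torus_oppK : involutive (@torus_opp R nu).
Proof.
move=> x; apply: torus_eq => k; rewrite !torus_oppE.
have [->|xk] := eqVneq (tnth (torus_coord x) k) (- pi); first by rewrite eqxx.
rewrite eqr_opp opprK; case: eqP => // xpi.
by have /andP[_] := torus_coord_bounds x k; rewrite xpi ltxx.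
Qed.

Lemma measurable_torus_coord k :
  measurable_fun [set: torus] (fun x => tnth (torus_coord x) k).
Proof.
apply: (@measurableT_comp _ _ _ _ _ _ (@tnth nu R ^~ k)) => //.
  exact: measurable_tnth.
by move=> _ B mB; rewrite setTI; exists B => //; rewrite setTI.
Qed.

Lemma measurable_torus_opp : measurable_fun [set: torus] (@torus_opp R nu).
Proof.
suff mc : measurable_fun [set: torus] (@torus_coord R nu \o @torus_opp R nu).
  move=> _ A [B mB <-]; rewrite !setTI -comp_preimage -[X in measurable X]setTI.
  exact: mc.
apply/measurable_fun_tnthP => k.
(* Negation takes [- pi] to [pi]; the indicator term subtracts [2 pi] there and restores [- pi]. *)
rewrite (_ : _ \o _ = (fun x : torus => - tnth (torus_coord x) k +
    (- (pi *+ 2)) * \1_[set - pi] (tnth (torus_coord x) k))); last first.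
  apply/funext => x /=; rewrite torus_oppE indicE in_set1.
  case: eqP => [->|]; last by rewrite mulr0 addr0.
  by rewrite mulr1 mulr2n; ring.
apply: measurable_funD; first by apply: measurable_funN; exact: measurable_torus_coord.
apply: measurable_funM; first exact: measurable_cst.
apply: measurableT_comp; last exact: measurable_torus_coord.
exact: measurable_indic.
Qed.

End torus_involution.

(** * Invariance of [G j j] under reflection, symmetrization and the Hilbert space [K1] *)

Section symmetrization.
Variables (R : realType) (nu d : nat) (G : spectral_measure R nu d) (j : 'I_d).
Local Notation torus := (torus R nu).
Local Notation mu := (diag_measure G j).

(** The values of [G j j] are real, so the conjugate in [spectral_sym] disappears; for an
    involution, image and preimage coincide. *)
Lemma diag_measure_opp (A : set torus) : measurable A ->
  mu (@torus_opp R nu @^-1` A) = mu A.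
Proof.
move=> mA.
have E : @torus_opp R nu @` A = @torus_opp R nu @^-1` A.
  apply/seteqP; split => [_ [x Ax <-]|x Ax] /=; first by rewrite torus_oppK.
  by exists (torus_opp x) => //; exact: torus_oppK.
have mE : measurable (@torus_opp R nu @^-1` A).
  by rewrite -[X in measurable X]setTI; exact: measurable_torus_opp.
have fin B : measurable B -> mu B \is a fin_num.
  move=> mB; rewrite ge0_fin_numE//.
  by apply: le_lt_trans (diag_measure_fin G j); apply: le_measure; rewrite ?inE.
have := spectral_sym G j j mA.
rewrite E !diag_measureE// conjc_real => /(@complexI R) h.
by rewrite -[LHS]fineK ?fin// h fineK// fin.
Qed.

Let pushforward_opp (A : set torus) : measurable A -> A `<=` setT ->
  pushforward mu (@torus_opp R nu) A = mu A.
Proof. by move=> mA _; exact: diag_measure_opp. Qed.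

Lemma ge0_integral_opp (f : torus -> \bar R) : measurable_fun [set: torus] f ->
  (forall x, 0 <= f x)%E -> (\int[mu]_x f (torus_opp x) = \int[mu]_x f x)%E.
Proof.
move=> mf f0.
have := @ge0_integral_pushforward _ _ _ _ _ _ (@measurable_torus_opp R nu) mu setT f measurableT mf.
rewrite (eq_measure_integral _ pushforward_opp); first by move=> h; rewrite -h//.
exact: measurable_torus_opp.
Qed.

Lemma integral_opp (f : torus -> \bar R) :
  mu.-integrable [set: torus] (f \o @torus_opp R nu) -> measurable_fun [set: torus] f ->
  (\int[mu]_x f (torus_opp x) = \int[mu]_x f x)%E.
Proof.
move=> If mf.
have := @integral_pushforward _ _ _ _ _ _ (@measurable_torus_opp R nu) mu setT f mf.
rewrite (eq_measure_integral _ pushforward_opp); first by move=> ->.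
exact: measurable_torus_opp.
Qed.

Definition symm (f : torus -> R[i]) (x : torus) : R[i] :=
  (2^-1)%:C * (f x + (f (torus_opp x))^*%C).

Lemma symm_opp f x : symm f (torus_opp x) = (symm f x)^*%C.
Proof. by rewrite /symm torus_oppK conjcM conjcD conjcK conjc_real addrC. Qed.

Lemma symm_id f : (forall x, f (torus_opp x) = (f x)^*%C) -> symm f = f.
Proof.
move=> fs; apply/funext => x; rewrite /symm fs conjcK -mulr2n -[X in _ * X]mulr_natl mulrA.
by rewrite -(rmorph_nat (real_complex R)) -rmorphM/= mulVf// mul1r.
Qed.

Lemma symmB f g x : symm (fun y => f y - g y) x = symm f x - symm g x.
Proof. by rewrite /symm conjcB -mulrBr opprD addrACA. Qed.

Let sq_integrable_opp (f : torus -> R[i]) : sq_integrable mu f ->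
  sq_integrable mu (fun x => (f (torus_opp x))^*%C).
Proof.
move=> [mf If]; split.
  by have := cmeasurable_comp (cmeasurableJ mf) (@measurable_torus_opp R nu).
under eq_integral do rewrite normcJ.
rewrite (ge0_integral_opp (f := fun x => (normc (f x) ^+ 2)%:E))//.
  exact: measurable_normc_sqr.
by move=> x; rewrite lee_fin sqr_ge0.
Qed.

Lemma sq_integrable_symm f : sq_integrable mu f -> sq_integrable mu (symm f).
Proof.
by move=> If; apply: sq_integrableM; apply: sq_integrableD => //; exact: sq_integrable_opp.
Qed.

Let half_le (x y : R) : x <= y + y -> 2^-1 * x <= y.
Proof. lra. Qed.

(** By invariance of the measure, the reflected conjugate of [f] has the norm of [f]; then the
    triangle inequality bounds the average. *)
Lemma norm_symm_le f : sq_integrable mu f -> `|toL2 mu (symm f)| <= `|toL2 mu f|.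
Proof.
move=> If; have Iof := sq_integrable_opp If.
rewrite toL2Z; last exact: sq_integrableD.
rewrite toL2D// normrZ gtr0_norm ?invr_gt0//.
have E : `|toL2 mu (fun x => (f (torus_opp x))^*%C)| = `|toL2 mu f|.
  rewrite (norm_toL2 If) (norm_toL2 Iof); under eq_integral do rewrite normcJ.
  rewrite (ge0_integral_opp (f := fun x => (normc (f x) ^+ 2)%:E))//.
    by apply: measurable_normc_sqr; case: If.
  by move=> x; rewrite lee_fin sqr_ge0.
apply: half_le; apply: le_trans (ler_normD _ _) _.
rewrite E; exact: lexx.
Qed.

Lemma K1P (u : L2 mu) : K1 G j u <-> exists2 f, sq_integrable mu f &
  u = toL2 mu f /\ forall x, f (torus_opp x) = (f x)^*%C.
Proof.
split=> [[f [If fs] <-]|[f If [-> fs]]]; first by exists f.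
by exists f.
Qed.

Lemma K1_linear (a : R) u v : K1 G j u -> K1 G j v -> K1 G j (a *: u + v).
Proof.
move=> /K1P[f If [-> fs]] /K1P[g Ig [-> gs]]; apply/K1P.
have Iaf := sq_integrableM a%:C If.
exists (fun x => a%:C * f x + g x); first exact: sq_integrableD.
rewrite toL2D// toL2Z//; split=> // x.
by rewrite fs gs conjcD conjcM conjc_real.
Qed.

Lemma K1_0 : K1 G j 0.
Proof.
apply/K1P; exists (fun=> 0); first exact: sq_integrable0.
by rewrite toL20; split=> // x; rewrite conjc0.
Qed.

(** [symm] is a contraction fixing the symmetric representative of [u], so symmetrizing an
    approximant brings it no farther from [u]. Both the closedness of [K1] and the density of real
    combinations of characters rest on this. *)
Lemma K1_symm_approx (u : L2 mu) f : K1 G j u -> sq_integrable mu f ->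
  `|u - toL2 mu (symm f)| <= `|u - toL2 mu f|.
Proof.
move=> /K1P[g Ig [-> gs]] If; have Isf := sq_integrable_symm If.
have Igf := sq_integrableB Ig If.
rewrite -[in leLHS](symm_id gs) -(toL2B (sq_integrable_symm Ig) Isf) -(toL2B Ig If).
apply: le_trans (norm_symm_le Igf).
suff -> : symm (fun x => g x - f x) = fun x => symm g x - symm f x by exact: lexx.
by apply/funext => x; rewrite symmB.
Qed.

(** Membership asks for a representative symmetric at every point. For any representative [f] of the
    limit, [symm f] is one: it is as close to the [u_ n] as [f] is, hence in the class of [l]. *)
Lemma K1_closed (u_ : nat -> L2 mu) (l : L2 mu) : (forall n, K1 G j (u_ n)) ->
  u_ @ \oo --> l -> K1 G j l.
Proof.
move=> Ku ul; have [f If lE] := toL2_ex l.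
have Isf := sq_integrable_symm If.
suff -> : l = toL2 mu (symm f) by apply/K1P; exists (symm f) => //; split=> // x; exact: symm_opp.
apply: le_eps_eq => e e0.
have e20 : 0 < e / 2 by rewrite divr_gt0.
move/cvgrPdist_lt : ul => /(_ _ e20)[n _ /(_ n (leqnn n))] /= un.
rewrite -(subrK (u_ n) l) -addrA (le_trans (ler_normD _ _))// [leRHS]splitr lerD ?ltW//.
by rewrite (le_lt_trans (K1_symm_approx (Ku n) If))// -lE distrC.
Qed.

(** Reflection conjugates the integrand, so its imaginary part is odd while the measure is
    invariant. *)
Lemma K1_dot_real u v : K1 G j u -> K1 G j v -> complex.Im (L2dot u v) = 0.
Proof.
move=> /K1P[f If [-> fs]] /K1P[g Ig [-> gs]]; rewrite L2dot_toL2//=.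
pose h x := complex.Im (f x * (g x)^*%C).
have ho x : h (torus_opp x) = - h x.
  by rewrite /h fs gs -conjcM ImJ.
have [_ Ih] := cintegrable_mulJ If Ig.
have Iho : mu.-integrable [set: torus] ((EFin \o h) \o @torus_opp R nu).
  rewrite (_ : _ \o _ = (\- (EFin \o h))%E); first exact: integrableN.
  by apply/funext => x /=; rewrite ho EFinN.
have := integral_opp Iho (measurable_int _ Ih).
move/(congr1 fine); rewrite -/(Rintegral mu setT h) => E.
have : - Rintegral mu setT h = Rintegral mu setT h.
  rewrite -[in RHS]E -mulN1r -RintegralZl//; congr fine.
  by apply: eq_integral => x _; rewrite /= ho mulN1r.
by rewrite -/h; lra.
Qed.

Lemma K1_hilbert : real_hilbert_space (K1 G j) (@L2dot _ _ R mu).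
Proof.
split.
- by split; [exact: K1_0|move=> a u v; exact: K1_linear].
- exact: K1_dot_real.
- split=> [u v Ku Kv|a u v w _ _ _]; last exact: L2dotDl.
  rewrite [RHS]L2dotC; apply: eqc_ReIm; rewrite ?ReJ ?ImJ//.
  by rewrite K1_dot_real// oppr0.
- split=> u _; last by rewrite L2dot_norm.
  rewrite L2dot_norm; split; first by rewrite ler0c sqr_ge0.
  by move=> /(@complexI R _ 0)/eqP; rewrite sqrf_eq0 => /eqP /normr0_eq0.
- move=> u_ Ku /L2_complete[l ul]; exists l => //; exact: K1_closed ul.
Qed.

End symmetrization.

(** * Density of trigonometric polynomials *)

Section characters.
Variables (R : realType) (nu : nat).
Local Notation torus := (torus R nu).
Implicit Types (p q : 'I_nu -> int) (x : torus) (f g : torus -> R[i]).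

Lemma characterM p q x : character p x * character q x = character (fun k => p k + q k) x.
Proof.
rewrite /character; under [in RHS]eq_bigr do rewrite intrD mulrDl.
by rewrite big_split cosD sinD; apply: eqc_ReIm; rewrite ?ReM ?ImM/= //; ring.
Qed.

Lemma character0 x : character (fun=> 0) x = 1.
Proof. by rewrite /character big1 => [|k _]; rewrite ?mul0r// cos0 sin0. Qed.

Lemma characterN p x : character (fun k => - p k) x = (character p x)^*%C.
Proof.
rewrite /character; under [in LHS]eq_bigr do rewrite intrN mulNr.
by rewrite sumrN cosN sinN.
Qed.

Lemma normc_character p x : normc (character p x) = 1.
Proof. by rewrite /= cos2Dsin2 sqrtr1. Qed.

Lemma cmeasurable_character p : cmeasurable (character p : torus -> R[i]).
Proof.
have m : measurable_fun [set: torus] (fun x => \sum_k (p k)%:~R * tnth (torus_coord x) k).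
  apply: measurable_sum => k; apply: measurable_funM; first exact: measurable_cst.
  exact: measurable_torus_coord.
split.
- by apply: (measurableT_comp (continuous_measurable_fun (@continuous_cos R)) m).
- by apply: (measurableT_comp (continuous_measurable_fun (@continuous_sin R)) m).
Qed.

Let character_turn (a : R) (m : int) : cos (a + m%:~R * (pi *+ 2)) = cos a /\
  sin (a + m%:~R * (pi *+ 2)) = sin a.
Proof.
have nat_turn (b : R) (n : nat) : cos (b + n%:R * (pi *+ 2)) = cos b /\
    sin (b + n%:R * (pi *+ 2)) = sin b.
  elim: n => [|n [IHc IHs]]; first by rewrite mul0r addr0.
  by rewrite -natr1 mulrDl mul1r addrA cosD2pi sinD2pi.
case: m => n; first exact: nat_turn.
rewrite NegzE intrN mulNr.
have [] := nat_turn (a - n.+1%:R * (pi *+ 2)) n.+1.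
by rewrite subrK => -> ->.
Qed.

(** A coordinate kept at [- pi] instead of negated changes the phase by [- p k] turns of [2 pi],
    which is invisible because [p k] is an integer. *)
Lemma character_opp p x : character p (torus_opp x) = (character p x)^*%C.
Proof.
rewrite -characterN /character.
rewrite (_ : \sum_k (p k)%:~R * tnth (torus_coord (torus_opp x)) k =
  \sum_k (- p k)%:~R * tnth (torus_coord x) k +
  (\sum_k if tnth (torus_coord x) k == - pi then - p k else 0)%:~R * (pi *+ 2)).
  by have [-> ->] := character_turn (\sum_k (- p k)%:~R * tnth (torus_coord x) k)
    (\sum_k if tnth (torus_coord x) k == - pi then - p k else 0).
rewrite rmorph_sum/= mulr_suml -big_split/=; apply: eq_bigr => k _.
rewrite torus_oppE; case: eqP => [->|_]; rewrite ?intrN mulr2n; first ring.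
by ring.
Qed.

(** Complex trigonometric polynomials; generating them inductively turns closure properties into
    inductions without index families. *)
Inductive trig : (torus -> R[i]) -> Prop :=
| trig_char (c : R[i]) p : trig (fun x => c * character p x)
| trig_add f g : trig f -> trig g -> trig (fun x => f x + g x).

Lemma trig_ext f g : (forall x, f x = g x) -> trig f -> trig g.
Proof. by move=> /funext ->. Qed.

Lemma trig_mul f g : trig f -> trig g -> trig (fun x => f x * g x).
Proof.
elim=> [c p|f1 f2 _ IH1 _ IH2] tg.
  elim: tg => [c' q|g1 g2 _ IH1 _ IH2].
    apply: trig_ext (trig_char (c * c') (fun k => p k + q k)) => x.
    by rewrite -characterM mulrACA.
  by apply: trig_ext (trig_add IH1 IH2) => x; rewrite mulrDr.
by apply: trig_ext (trig_add (IH1 tg) (IH2 tg)) => x; rewrite mulrDl.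
Qed.

Lemma trig_cst (c : R[i]) : trig (fun=> c).
Proof. by apply: trig_ext (trig_char c (fun=> 0)) => x; rewrite character0 mulr1. Qed.

Lemma trig_scale (c : R[i]) f : trig f -> trig (fun x => c * f x).
Proof. by move=> tf; exact: trig_mul (trig_cst c) tf. Qed.

Lemma cmeasurable_trig f : trig f -> cmeasurable f.
Proof.
elim=> [c p|f1 f2 _ IH1 _ IH2]; last exact: cmeasurableD.
by apply: cmeasurableM; [exact: cmeasurable_cst|exact: cmeasurable_character].
Qed.

Lemma trig_bounded f : trig f -> exists M, forall x, normc (f x) <= M.
Proof.
elim=> [c p|f1 f2 _ [M1 h1] _ [M2 h2]].
  by exists (normc c) => x; rewrite normcM normc_character mulr1.
by exists (M1 + M2) => x; rewrite (le_trans (ler_normcD _ _))// lerD.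
Qed.

Let pulse (k : 'I_nu) (a : int) : 'I_nu -> int := fun l => if l == k then a else 0.

Let pulseE k a x : \sum_l (pulse k a l)%:~R * tnth (torus_coord x) l =
  a%:~R * tnth (torus_coord x) k.
Proof.
rewrite (bigD1 k)//= /pulse eqxx big1 ?addr0// => l lk.
by rewrite (negbTE lk) mul0r.
Qed.

Lemma trig_cos k : trig (fun x => (cos (tnth (torus_coord x) k))%:C).
Proof.
apply: trig_ext (trig_add (trig_char (2^-1)%:C (pulse k 1)) (trig_char (2^-1)%:C (pulse k (-1)))) => x.
rewrite /character !pulseE mul1r mulN1r cosN sinN.
by apply: eqc_ReIm; rewrite ?ReD ?ImD ?ReM ?ImM /=; field.
Qed.

Lemma trig_sin k : trig (fun x => (sin (tnth (torus_coord x) k))%:C).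
Proof.
(* Euler's formula: the coefficients are [1 / (2 i) = - i / 2] and [- 1 / (2 i) = i / 2]. *)
apply: trig_ext (trig_add (trig_char (0 -i* 2^-1) (pulse k 1)) (trig_char (0 +i* 2^-1) (pulse k (-1)))) => x.
rewrite /character !pulseE mul1r mulN1r cosN sinN.
by apply: eqc_ReIm; rewrite ?ReD ?ImD ?ReM ?ImM /=; field.
Qed.

End characters.

(** * Bounded real functions that are L2 limits of trigonometric polynomials *)

Section good_functions.
Variables (R : realType) (nu : nat).
Local Notation torus := (torus R nu).
Variable mu : {measure set torus -> \bar R}.
Hypothesis mufin : (mu [set: torus] < +oo)%E.
Implicit Types (f g : torus -> R) (A : set torus).

Local Notation "f %:CF" := (fun x => (f x)%:C) (at level 2, format "f %:CF").

Lemma norm_toL2_le (f g : torus -> R[i]) (M : R) : cmeasurable f ->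
  sq_integrable mu g -> 0 <= M -> (forall x, normc (f x) <= M * normc (g x)) ->
  `|toL2 mu f| <= M * `|toL2 mu g|.
Proof.
move=> mf Ig M0 fg; have If := sq_integrable_le mf Ig fg.
have IMg := sq_integrableM M%:C Ig.
rewrite -[M in leRHS]ger0_norm// -normrZ -(toL2Z M Ig) (norm_toL2 If) (norm_toL2 IMg).
rewrite ler_sqrt; last first.
  by rewrite fine_ge0// integral_ge0// => x _; rewrite lee_fin sqr_ge0.
apply: fine_le; try (by rewrite -sqr_norm_toL2); apply: ge0_le_integral => //.
- by move=> x _; rewrite lee_fin sqr_ge0.
- exact: measurable_normc_sqr.
- by apply: measurable_normc_sqr; case: IMg.
- move=> x _; rewrite lee_fin lerXn2r ?nnegrE ?normc_ge0//.
  by rewrite normcM normcR ger0_norm.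
Qed.

Let ltr_halfD (a b e : R) : a < e / 2 -> b < e / 2 -> a + b < e.
Proof. by move=> ha hb; rewrite [e]splitr ltrD. Qed.

(** Real values give access to order and absolute value; boundedness keeps products square
    integrable and controls their approximation. *)
Definition good f := [/\ measurable_fun [set: torus] f, exists M, forall x, `|f x| <= M &
  forall e : R, 0 < e -> exists2 t, trig t & `|toL2 mu f%:CF - toL2 mu t| < e].

Let sq_real f M : measurable_fun [set: torus] f -> (forall x, `|f x| <= M) ->
  sq_integrable mu f%:CF.
Proof.
move=> mf fM; apply: (sq_integrable_bounded (M := M) mufin (cmeasurable_real mf)) => x.
by rewrite normcR.
Qed.

Lemma sq_integrable_good f : good f -> sq_integrable mu f%:CF.
Proof. by move=> [mf [M fM] _]; exact: sq_real fM. Qed.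

Lemma sq_integrable_trig (t : torus -> R[i]) : trig t -> sq_integrable mu t.
Proof.
move=> tt; have [M tM] := trig_bounded tt.
by apply: (sq_integrable_bounded mufin) tM; exact: cmeasurable_trig.
Qed.

Lemma good_trig f : trig f%:CF -> good f.
Proof.
move=> tf; split.
- by have [] := cmeasurable_trig tf.
- by have [M fM] := trig_bounded tf; exists M => x; rewrite -normcR.
- by move=> e e0; exists f%:CF => //; rewrite subrr normr0.
Qed.

Lemma good_cst (a : R) : good (fun=> a).
Proof. by apply: good_trig; exact: trig_cst. Qed.

Lemma good_add f g : good f -> good g -> good (fun x => f x + g x).
Proof.
move=> gf gg; have If := sq_integrable_good gf; have Ig := sq_integrable_good gg.
have [mf [Mf fM] hf] := gf; have [mg [Mg gM] hg] := gg.
split; first exact: measurable_funD.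
  by exists (Mf + Mg) => x; rewrite (le_trans (ler_normD _ _))// lerD.
move=> e e0; have e20 : 0 < e / 2 by rewrite divr_gt0.
have [t tt ft] := hf _ e20; have [s ts gs] := hg _ e20.
exists (fun x => t x + s x); first exact: trig_add.
rewrite (_ : (fun x => (f x + g x)%:C) = (fun x => (f x)%:C + (g x)%:C)); last first.
  by apply/funext => x; rewrite rmorphD.
rewrite (toL2D If Ig) (toL2D (sq_integrable_trig tt) (sq_integrable_trig ts)).
rewrite opprD addrACA; apply: le_lt_trans (ler_normD _ _) _.
exact: ltr_halfD ft gs.
Qed.

(** Write [f g - t s = f (g - s) + (f - t) s]. The polynomial [s] is chosen from the bound of [f];
    only then is [t] chosen, with a tolerance depending on the bound of [s]. *)
Lemma good_mul f g : good f -> good g -> good (fun x => f x * g x).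
Proof.
move=> gf gg; have If := sq_integrable_good gf; have Ig := sq_integrable_good gg.
have [mf [Mf fM] hf] := gf; have [mg [Mg gM] hg] := gg.
have mfg : measurable_fun [set: torus] (fun x => f x * g x) by exact: measurable_funM.
have fgM x : `|f x * g x| <= Mf * Mg by rewrite normrM ler_pM.
split; [exact: mfg|by exists (Mf * Mg)|].
move=> e e0.
have small (M : R) : exists2 r, 0 < r & `|M| * r <= e / 2.
  have M0 : 0 < `|M| + 1 by rewrite ltr_wpDl.
  exists (e / 2 / (`|M| + 1)); first by rewrite !divr_gt0.
  by rewrite mulrCA ger_pMr ?divr_gt0// ler_pdivrMr// mul1r lerDl.
have [rf rf0 hrf] := small Mf.
have [s ts gs] := hg _ rf0.
have [Ms sM] := trig_bounded ts.
have [rs rs0 hrs] := small Ms.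
have [t tt ft] := hf _ rs0.
have It := sq_integrable_trig tt; have Is := sq_integrable_trig ts.
have Ifg := sq_real mfg fgM.
have Ifs : sq_integrable mu (fun x => (f x)%:C * s x).
  apply: (sq_integrable_le (M := Mf) _ Is).
    by apply: cmeasurableM; [exact: cmeasurable_real|exact: cmeasurable_trig].
  by move=> x; rewrite normcM normcR ler_wpM2r ?normc_ge0.
have Its := sq_integrable_trig (trig_mul tt ts).
exists (fun x => t x * s x); first exact: trig_mul.
rewrite -(subrK (toL2 mu (fun x => (f x)%:C * s x)) (toL2 mu _)) -addrA.
apply: le_lt_trans (ler_normD _ _) _; rewrite -(toL2B Ifg Ifs) -(toL2B Ifs Its).
have Igs := sq_integrableB Ig Is; have Ift := sq_integrableB If It.
have H1 : `|toL2 mu (fun x => (f x * g x)%:C - (f x)%:C * s x)| <=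
    `|Mf| * `|toL2 mu (fun x => (g x)%:C - s x)|.
  apply: norm_toL2_le => //; first by case: (sq_integrableB Ifg Ifs).
  move=> x; rewrite rmorphM -mulrBr normcM normcR ler_wpM2r ?normc_ge0//.
  exact: le_trans (fM x) (ler_norm _).
have H2 : `|toL2 mu (fun x => (f x)%:C * s x - t x * s x)| <=
    `|Ms| * `|toL2 mu (fun x => (f x)%:C - t x)|.
  apply: norm_toL2_le => //; first by case: (sq_integrableB Ifs Its).
  move=> x; rewrite -mulrBl normcM mulrC ler_wpM2r ?normc_ge0//.
  exact: le_trans (sM x) (ler_norm _).
rewrite [ltRHS]splitr.
move: gs ft; rewrite -(toL2B Ig Is) -(toL2B If It) => gs ft.
(* Multiplying by [|Ms|] keeps an inequality strict only if it is positive; otherwise the second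
   term vanishes. *)
have [Ms0|Ms0] := eqVneq `|Ms| 0.
  apply: ler_ltD; first by apply: le_trans H1 _; apply: le_trans hrf; rewrite ler_wpM2l// ltW.
  by apply: le_lt_trans H2 _; rewrite Ms0 mul0r divr_gt0.
apply: ler_ltD; first by apply: le_trans H1 _; apply: le_trans hrf; rewrite ler_wpM2l// ltW.
apply: le_lt_trans H2 _; apply: lt_le_trans hrs.
by rewrite ltr_pM2l// lt_neqAle eq_sym Ms0 normr_ge0.
Qed.

Lemma good_scale (a : R) f : good f -> good (fun x => a * f x).
Proof. by move=> gf; exact: good_mul (good_cst a) gf. Qed.

Lemma good_sub f g : good f -> good g -> good (fun x => f x - g x).
Proof.
move=> gf gg; have := good_add gf (good_scale (-1) gg).
by under eq_fun do rewrite mulN1r.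
Qed.

Lemma good_exp f n : good f -> good (fun x => f x ^+ n).
Proof.
move=> gf; elim: n => [|n IH]; first exact: good_cst.
by under eq_fun do rewrite exprS; exact: good_mul.
Qed.

(** The mass is finite, so the constant [2 M] dominates the errors and the bounded pointwise limit
    is a limit in [L2]. *)
Lemma good_lim (f_ : nat -> torus -> R) f (M : R) : (forall n, good (f_ n)) ->
  (forall n x, `|f_ n x| <= M) -> (forall x, f_ ^~ x @ \oo --> f x) -> good f.
Proof.
move=> gf_ f_M ff.
have mf : measurable_fun [set: torus] f.
  by apply: (@measurable_fun_cvg _ _ _ _ f_) => [n|x _]; [case: (gf_ n)|exact: ff].
have fM x : `|f x| <= M.
  have cf : (fun n => `|f_ n x|) @ \oo --> `|f x| by exact: cvg_norm (ff x).
  rewrite -(cvg_lim _ cf)//; apply: limr_le; first by apply/cvg_ex; exists `|f x|.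
  exact: nearW.
split; [exact: mf|by exists M|].
move=> e e0; have e20 : 0 < e / 2 by rewrite divr_gt0.
have M0 : 0 <= M by exact: le_trans (normr_ge0 _) (fM (point : torus)).
have : (fun n => toL2 mu (f_ n)%:CF) @ \oo --> toL2 mu f%:CF.
  apply: (@L2_dominated_cvg _ _ _ _ _ _ (fun=> M *+ 2)).
  - by move=> n; exact: sq_integrable_good.
  - exact: sq_real fM.
  - apply/integrableP; split; first exact: measurable_cst.
    by rewrite integral_cst// lte_mul_pinfty.
  - by move=> n x; rewrite -rmorphB normcR mulr2n (le_trans (ler_normB _ _))// lerD.
  - move=> x; rewrite (_ : (fun n => _) = fun n => `|f_ n x - f x|); last first.
      by apply/funext => n; rewrite -rmorphB normcR.
    rewrite -[X in _ --> X](@normr0 _ R); apply: cvg_norm.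
    by rewrite -(subrr (f x)); apply: cvgB; [exact: ff|exact: cvg_cst].
move/cvgrPdist_lt => /(_ _ e20)[n _ /(_ n (leqnn n))] /= fn.
have [_ _ /(_ _ e20)[t tt ft]] := gf_ n.
exists t => //; rewrite -(subrK (toL2 mu (f_ n)%:CF) (toL2 mu f%:CF)) -addrA.
apply: le_lt_trans (ler_normD _ _) _; exact: ltr_halfD fn ft.
Qed.

Definition good_set A := good (\1_A).

Lemma good_indic (f : torus -> R) A : good f -> (forall x, A x -> f x = 1) ->
  (forall x, ~ A x -> f x = 0) -> good_set A.
Proof.
move=> gf f1 f0; rewrite /good_set (_ : \1_A = f)//; apply/funext => x.
rewrite indicE; have [xA|xA] := boolP (x \in A); first by rewrite f1//; rewrite inE in xA.
by rewrite f0// => Ax; move: xA; rewrite mem_set.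
Qed.

Lemma good_setC A : good_set A -> good_set (~` A).
Proof.
move=> gA; apply: good_indic (good_sub (good_cst 1) gA) _ _ => x xA.
  by rewrite indicE memNset ?subr0.
by rewrite indicE mem_set ?subrr//; exact: contrapT.
Qed.

Lemma good_setI A (B : set torus) : good_set A -> good_set B -> good_set (A `&` B).
Proof. by move=> gA gB; rewrite /good_set indicI; exact: good_mul gA gB. Qed.

(** The indicator of the complement of the union is the pointwise limit of the finite products of
    [1 - \1_(F i)], which are eventually constant at each point. *)
Lemma good_bigcup (F : nat -> set torus) : (forall n, good_set (F n)) ->
  good_set (\bigcup_n F n).
Proof.
move=> gF; rewrite -[X in good_set X]setCK; apply: good_setC.
pose h n x := \prod_(i < n) (1 - \1_(F i) x) : R.
have gh n : good (h n).
  elim: n => [|n IH].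
    rewrite (_ : h 0%N = fun=> 1); first exact: good_cst.
    by apply/funext => x; rewrite /h big_ord0.
  rewrite (_ : h n.+1 = fun x => h n x * (1 - \1_(F n) x)).
    exact: good_mul IH (good_sub (good_cst 1) (gF n)).
  by apply/funext => x; rewrite /h big_ord_recr.
have hle n x : `|h n x| <= 1.
  rewrite /h; elim: n => [|n IH]; first by rewrite big_ord0 normr1.
  rewrite big_ord_recr/= normrM mulr_ile1// indicE.
  by case: (_ \in _); rewrite ?subrr ?subr0 ?normr0 ?normr1.
apply: (good_indic (f := \1_(~` \bigcup_n F n))); last 2 first.
- by move=> x hx; rewrite indicE mem_set.
- by move=> x hx; rewrite indicE memNset.
apply: (good_lim gh hle) => x.
have [[m _ Fmx]|hx] := pselect ((\bigcup_n F n) x).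
  rewrite indicE memNset; last by apply; exists m.
  apply: cvg_near_cst; exists m.+1 => // n /= mn; apply/eqP.
  by rewrite /h (bigD1 (Ordinal mn))//= indicE mem_set// subrr mul0r.
rewrite indicE mem_set//; apply: cvg_near_cst; apply: nearW => n.
rewrite /h big1// => i _; rewrite indicE memNset ?subr0// => Fix_; apply: hx.
by exists i.
Qed.

Let normalize f : good f -> exists2 M, 0 < M & forall x, `|M^-1 * f x| <= 1.
Proof.
move=> [_ [M fM] _]; have M0 : 0 < `|M| + 1 by rewrite ltr_wpDl.
exists (`|M| + 1) => // x; rewrite normrM gtr0_norm ?invr_gt0// mulrC ler_pdivrMr// mul1r.
by rewrite (le_trans (fM x))// (le_trans (ler_norm _))// lerDl.
Qed.

(* [(1 - f^2)^n] decreases to the indicator of the zero set when [|f| <= 1]. *)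
Lemma good_zero f : good f -> good_set [set x | f x = 0].
Proof.
move=> gf; have [M M0 hM] := normalize gf.
pose g x := 1 - (M^-1 * f x) ^+ 2.
have gg : good g := good_sub (good_cst 1) (good_exp 2 (good_scale M^-1 gf)).
have g01 x : 0 <= g x <= 1.
  rewrite /g lerBlDr lerDl sqr_ge0 andbT subr_ge0 -real_normK ?num_real//.
  by rewrite expr_le1 ?normr_ge0.
apply: (good_lim (f_ := fun n x => g x ^+ n) (M := 1) (fun n => good_exp n gg)).
- move=> n x; have /andP[g0 g1] := g01 x.
  by rewrite normrX ger0_norm// exprn_ile1.
move=> x; rewrite indicE; have [xA|xA] := boolP (_ \in _).
  move: xA; rewrite inE /= => f0.
  rewrite (_ : (fun n => g x ^+ n) = cst 1); first exact: cvg_cst.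
  by apply/funext => n; rewrite /g f0 mulr0 expr0n subr0 expr1n.
have f0 : f x != 0 by apply/eqP => f0; move: xA; rewrite mem_set.
have /andP[g0 g1] := g01 x.
apply: cvg_expr; rewrite ger0_norm// /g ltrBlDr ltrDl exprn_even_gt0//=.
by rewrite mulf_neq0// invr_neq0// gt_eqF.
Qed.

(* The iteration [y <- y + (t^2 - y^2) / 2] from 0 increases to [|t|]. *)
Lemma good_norm f : good f -> good (fun x => `|f x|).
Proof.
move=> gf; have [M M0 hM] := normalize gf.
pose g x := M^-1 * f x; have gg : good g := good_scale M^-1 gf.
suff : good (fun x => `|g x|).
  move/(good_scale M); congr good; apply/funext => x.
  by rewrite /g normrM gtr0_norm ?invr_gt0// mulrA divff ?gt_eqF// mul1r.
pose y := fix y n x : R :=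
  if n is m.+1 then y m x + 2^-1 * (g x ^+ 2 - y m x ^+ 2) else 0.
have gy n : good (y n).
  elim: n => [|n IH]; first exact: good_cst 0.
  exact: good_add IH (good_scale 2^-1 (good_sub (good_exp 2 gg) (good_exp 2 IH))).
have yb n x : 0 <= y n x <= `|g x|.
  have := hM x; rewrite -/(g x) => h1.
  elim: n => [|n] /=; first by rewrite lexx normr_ge0.
  move=> /andP[y0 y1]; rewrite -(real_normK (num_real (g x))).
  by apply/andP; split; nra.
(* The next error is [(|g| - y) * (1 - (|g| + y) / 2)], and [y >= 0]. *)
have yc n x : `|g x| - y n x <= `|g x| * (1 - `|g x| / 2) ^+ n.
  have := hM x; rewrite -/(g x) => h1.
  elim: n => [|n IH]; first by rewrite subr0 expr0 mulr1.
  rewrite exprSr mulrA /=; apply: le_trans (_ : (`|g x| - y n x) * (1 - `|g x| / 2) <= _).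
    have /andP[y0 y1] := yb n x; rewrite -(real_normK (num_real (g x))).
    by move: y0 y1 h1; set a := `|g x|; set b := y n x; nra.
  by rewrite ler_wpM2r// subr_ge0 ler_pdivrMr// mul1r (le_trans h1)// ler1n.
apply: (good_lim (f_ := y) (M := 1) gy).
  move=> n x; have /andP[y0 y1] := yb n x.
  by rewrite ger0_norm// (le_trans y1)// hM.
move=> x; have h1 : `|g x| <= 1 := hM x.
have [g0|g0] := eqVneq `|g x| 0.
  rewrite g0 (_ : y ^~ x = cst 0); first exact: cvg_cst.
  by apply/funext => n; apply/eqP; rewrite eq_le -{1}g0 andbC; exact: yb.
apply: (@squeeze_cvgr _ _ _ _ (fun n => `|g x| - `|g x| * (1 - `|g x| / 2) ^+ n) (cst `|g x|)).
- apply: nearW => n; have /andP[_ ->] := yb n x.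
  by rewrite andbT lerBlDr addrC -lerBlDr.
- rewrite -[X in _ --> X]subr0; apply: cvgB; first exact: cvg_cst.
  rewrite -[X in _ --> X](mulr0 `|g x|); apply: cvgM; first exact: cvg_cst.
  have gpos : 0 < `|g x| by rewrite lt_neqAle eq_sym g0 normr_ge0.
  by apply: cvg_expr; rewrite ger0_norm; lra.
- exact: cvg_cst.
Qed.

(** [f + |f|] is twice the positive part, so the condition becomes a zero set. *)
Lemma good_le0 f : good f -> good_set [set x | f x <= 0].
Proof.
move=> gf; rewrite (_ : [set x | _] = [set x | f x + `|f x| = 0]).
  exact: good_zero (good_add gf (good_norm gf)).
apply/seteqP; split => x /= fx.
  by rewrite ler0_norm// subrr.
by rewrite -oppr_ge0 (addr0_eq fx).
Qed.

Lemma good_le f (a : R) : good f -> good_set [set x | f x <= a].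
Proof.
move=> gf; rewrite (_ : [set x | _] = [set x | f x - a <= 0]).
  exact: good_le0 (good_sub gf (good_cst a)).
by apply/seteqP; split => x /=; rewrite subr_le0.
Qed.

Lemma good_lt f (a : R) : good f -> good_set [set x | f x < a].
Proof.
move=> gf; rewrite (_ : [set x | _] = ~` [set x | a - f x <= 0]).
  exact: good_setC (good_le0 (good_sub (good_cst a) gf)).
by apply/seteqP; split => x /=; rewrite subr_le0 ltNge => /negP.
Qed.

End good_functions.

(** * From half-spaces to Borel sets, and density of trigonometric polynomials *)

Section trigonometric_density.
Variables (R : realType) (nu : nat).
Local Notation torus := (torus R nu).
Variable mu : {measure set torus -> \bar R}.
Hypothesis mufin : (mu [set: torus] < +oo)%E.

Let cosk k := good_trig mu (@trig_cos R nu k).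
Let sink k := good_trig mu (@trig_sin R nu k).

Lemma good_setT : good_set mu [set: torus].
Proof. by apply: good_indic (good_cst mu 1) _ _ => // x; case. Qed.

Lemma good_set0 : good_set mu (@set0 torus).
Proof. by have := good_setC mufin good_setT; rewrite setCT. Qed.

(** The cosine is monotone on each half of [[- pi, pi)] and the sine tells the halves apart. For
    [0 < a < pi] the set is [sin > 0] and [cos <= cos a]; for [- pi < a <= 0] its complement is
    [sin <= 0] and [cos < cos a]. The zeros of the sine fall on the right side: [- pi] counts as
    negative, and 0 is excluded from the complement by the strict inequality. *)
Lemma good_coord_ge k (a : R) : good_set mu [set x : torus | a <= tnth (torus_coord x) k].
Proof.
have pi0 : 0 < pi :> R := pi_gt0 R.
have [api|api] := leP a (- pi).
  rewrite (_ : [set x | _] = setT); first exact: good_setT.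
  apply/seteqP; split => x //= _; have /andP[h _] := torus_coord_bounds x k.
  exact: le_trans h.
have [pia|pia] := leP pi a.
  rewrite (_ : [set x | _] = set0); first exact: good_set0.
  apply/seteqP; split => x //= ax; have /andP[_ h] := torus_coord_bounds x k.
  by have := lt_le_trans h pia; rewrite ltNge ax.
have [a0|a0] := ltP 0 a.
  rewrite (_ : [set x | _] = ~` [set x | sin (tnth (torus_coord x) k) <= 0] `&`
      [set x | cos (tnth (torus_coord x) k) <= cos a]); last first.
    apply/seteqP; split => x /=; have /andP[] := torus_coord_bounds x k;
      set t := tnth _ _ => t1 t2.
      move=> at_; split.
        by apply/negP; rewrite -ltNge sin_gt0_pi// t2 (lt_le_trans a0).
      by rewrite leNgt ltr_cos ?in_itv/= -?leNgt// ltW//= ?ltW// (lt_le_trans a0).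
    move=> [/negP]; rewrite -ltNge => st ct.
    have t0 : 0 <= t.
      rewrite leNgt; apply/negP => t0.
      have : 0 <= sin (- t) by apply: sin_ge0_pi; rewrite oppr_ge0 ltW//= lerNl.
      by rewrite sinN oppr_ge0 leNgt st.
    by rewrite leNgt -ltr_cos -?leNgt// in_itv/= ?t0 ?ltW.
  have G1 := good_setC mufin (good_le mufin 0 (sink k)).
  have G2 := good_le mufin (cos a) (cosk k).
  have G3 := good_setI mufin G1 G2.
  exact: G3.
rewrite (_ : [set x | _] = ~` ([set x | sin (tnth (torus_coord x) k) <= 0] `&`
    [set x | cos (tnth (torus_coord x) k) < cos a])); last first.
  rewrite -[LHS]setCK; congr (~` _).
  apply/seteqP; split => x /=; have /andP[] := torus_coord_bounds x k;
    set t := tnth _ _ => t1 t2.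
    move=> /negP; rewrite -ltNge => ta; have t0 := lt_le_trans ta a0; split.
      by rewrite -oppr_ge0 -sinN; apply: sin_ge0_pi; rewrite oppr_ge0 ltW//= lerNl.
    by rewrite -cosN -(cosN a) ltr_cos ?ltrN2// in_itv/= oppr_ge0 ?a0 ?(ltW t0)/= lerNl// ltW.
  move=> [st ct]; apply/negP; rewrite -ltNge.
  have t0 : t <= 0.
    rewrite leNgt; apply/negP => t0.
    by have : 0 < sin t by [apply: sin_gt0_pi; rewrite t0]; rewrite ltNge st.
  by move: ct; rewrite -cosN -(cosN a) ltr_cos ?ltrN2// in_itv/= oppr_ge0 ?a0 ?t0/= lerNl// ltW.
have G1 := good_le mufin 0 (sink k).
have G2 := good_lt mufin (cos a) (cosk k).
have G3 := good_setC mufin (good_setI mufin G1 G2).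
exact: G3.
Qed.

(** Two nested minimality arguments: Borel sets of the tuple space are generated by preimages under
    the coordinates, and those of the line by the half-lines from [a] to infinity. *)
Lemma good_measurable (A : set torus) : measurable A -> good_set mu A.
Proof.
move=> [B mB <-]; rewrite setTI.
pose S := [set C : set (nu.-tuple R) | good_set mu (torus_coord (nu:=nu) @^-1` C)].
have Ssigma : sigma_algebra setT S.
  split.
  - by rewrite /S /= preimage_set0; exact: good_set0.
  - by move=> C SC; rewrite /S /= setTD preimage_setC; have := good_setC mufin SC; exact.
  - by move=> F SF; rewrite /S /= preimage_bigcup; have := good_bigcup mufin SF; exact.
suff : S B by [].
move: B mB; apply: smallest_sub => //.
move=> C; rewrite -bigcup_seq => -[k _ [D mD <-]]; rewrite setTI.
pose S' := [set E : set R | S ((@tnth nu R ^~ k) @^-1` E)].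
suff : S' D by [].
have mD' : (@RGenCInfty.G R).-sigma.-measurable D by rewrite -RGenCInfty.measurableE.
move: D {mD} mD'; apply: smallest_sub.
  have [S1 S2 S3] := Ssigma; split.
  - by rewrite /S' /= preimage_set0.
  - by move=> E SE; have := S2 _ SE; rewrite /S' /= !setTD preimage_setC.
  - by move=> F SF; rewrite /S' /= preimage_bigcup; exact: S3.
move=> _ [a ->]; rewrite /S' /S /=.
have := good_coord_ge k a; congr good_set.
by apply/seteqP; split => x /=; rewrite in_itv/= andbT.
Qed.

Lemma trig_dense (u : L2 mu) (e : R) : 0 < e -> exists2 t, trig t & `|u - toL2 mu t| < e.
Proof.
move=> e0; have e20 : 0 < e / 2 by rewrite divr_gt0.
have [n [c [A [mA _ Is hs]]]] := simple_dense u e20.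
have IA s : sq_integrable mu (fun x => \1_(A s) x : R[i]).
  apply: (sq_integrable_bounded (M := 1) mufin (cmeasurable_indic _ (mA s))) => x.
  by rewrite indicE; case: (_ \in _); rewrite ?[normc 1]normc1 ?[normc 0]normc0.
have close s (r : R) : 0 < r -> exists2 t, trig t &
    `|toL2 mu (fun x => c s * \1_(A s) x) - toL2 mu t| < r.
  move=> r0; have [_ _ hA] := good_measurable (mA s).
  have M0 : 0 < normc (c s) + 1 by rewrite ltr_wpDl ?normc_ge0.
  have [t tt ht] := hA (r / (normc (c s) + 1)) (divr_gt0 r0 M0).
  exists (fun x => c s * t x); first exact: trig_scale.
  have It := sq_integrable_trig mufin tt.
  rewrite -(toL2B (sq_integrableM (c s) (IA s)) (sq_integrableM (c s) It)).
  have IAt := sq_integrableB (IA s) It.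
  apply: (@le_lt_trans _ _ ((normc (c s) + 1) * `|toL2 mu (fun x => \1_(A s) x - t x)|)).
    apply: norm_toL2_le => //.
    - by case: (sq_integrableB (sq_integrableM (c s) (IA s)) (sq_integrableM (c s) It)).
    - exact: ltW.
    - by move=> x; rewrite -mulrBr normcM ler_wpM2r ?normc_ge0// lerDl.
  rewrite mulrC -ltr_pdivlMr//.
  have E : (fun x => ((\1_(A s) x : R)%:C)) = (fun x => \1_(A s) x : R[i]).
    by apply/funext => x; rewrite !indicE; case: (_ \in _).
  by move: ht; rewrite E (toL2B (IA s) It).
(* As a predicate stable under sums, approximability passes to the finite sum by induction, without
   dividing the error by the number of terms. *)
pose cl (v : L2 mu) := forall r : R, 0 < r -> exists2 t, trig t & `|v - toL2 mu t| < r.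
have cl0 : cl 0.
  by move=> r r0; exists (fun=> 0); [exact: trig_cst|rewrite toL20 subrr normr0].
have clD v w : cl v -> cl w -> cl (v + w).
  move=> hv hw r r0; have r20 : 0 < r / 2 by rewrite divr_gt0.
  have [t tt ht] := hv _ r20; have [t' tt' ht'] := hw _ r20.
  exists (fun x => t x + t' x); first exact: trig_add.
  rewrite (toL2D (sq_integrable_trig mufin tt) (sq_integrable_trig mufin tt')).
  rewrite opprD addrACA; apply: le_lt_trans (ler_normD _ _) _.
  by rewrite [r]splitr; apply: ltrD; [exact: ht|exact: ht'].
have [t tt ht] : exists2 t, trig t &
    `|toL2 mu (fun x => \sum_s c s * \1_(A s) x) - toL2 mu t| < e / 2.
  rewrite toL2_sum => [|s _]; last exact: sq_integrableM.
  suff : cl (\sum_s toL2 mu (fun x => c s * \1_(A s) x)) by exact.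
  elim/big_ind : _ => [//|//|s _]; exact: close.
exists t => //.
rewrite -(subrK (toL2 mu (fun x => \sum_s c s * \1_(A s) x)) u) -addrA.
apply: le_lt_trans (ler_normD _ _) _.
by rewrite [e]splitr; apply: ltrD; [exact: hs|exact: ht].
Qed.

End trigonometric_density.

(** * The space H1 *)

Section isometry_onto.
Variables (R : realType) (nu d : nat) (G : spectral_measure R nu d).
Variables (dO : measure_display) (Omega : measurableType dO).
Variables (P : probability Omega R) (Z : random_spectral_measure G P) (j : 'I_d).
Local Notation mu := (diag_measure G j).
Local Notation I := (random_integral Z j).

Lemma random_integral_linear (a : R) u v : I (a *: u + v) = a *: I u + I v.
Proof. by have [Il _ _] := random_integral_extension Z j. Qed.

Lemma random_integral_norm u : `|I u| = `|u|.
Proof. by have [_ Ii _] := random_integral_extension Z j. Qed.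

Lemma random_integral0 : I 0 = 0.
Proof. by apply/normr0_eq0; rewrite random_integral_norm normr0. Qed.

Lemma random_integralD u v : I (u + v) = I u + I v.
Proof. by rewrite -[u in LHS]scale1r random_integral_linear scale1r. Qed.

Lemma random_integralZ (a : R) u : I (a *: u) = a *: I u.
Proof. by rewrite -[a *: u]addr0 random_integral_linear random_integral0 addr0. Qed.

Lemma sq_integrable_character p : sq_integrable mu (character p).
Proof.
apply: (sq_integrable_bounded (M := 1) (diag_measure_fin G j) (cmeasurable_character R p)) => x.
by rewrite normc_character.
Qed.

Lemma K1_character p : K1 G j (toL2 mu (character p)).
Proof.
apply/K1P; exists (character p); first exact: sq_integrable_character.
by split=> // x; exact: character_opp.
Qed.

Let field_span := [set X | exists n (c : 'I_n -> R) (p : 'I_n -> 'I_nu -> int),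
    X = \sum_k c k *: stationary_field Z j (p k)].

Lemma field_spanD X Y : field_span X -> field_span Y -> field_span (X + Y).
Proof.
move=> [m [c [p ->]]] [n [c' [p' ->]]].
exists (m + n)%N, (fun s => match fintype.split s with inl i => c i | inr k => c' k end),
  (fun s => match fintype.split s with inl i => p i | inr k => p' k end).
rewrite big_split_ord; congr (_ + _); apply: eq_bigr => i _.
  by rewrite -[lshift _ _]/(unsplit (inl i)) unsplitK.
by rewrite -[rshift _ _]/(unsplit (inr i)) unsplitK.
Qed.

Lemma field_span_K1 X : field_span X -> exists2 u, K1 G j u & X = I u.
Proof.
move=> [n [c [p ->]]].
exists (\sum_k c k *: toL2 mu (character (p k))).
  elim/big_ind : _ => [|u v Ku Kv|k _]; first exact: K1_0.
    by rewrite -[u]scale1r; exact: K1_linear.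
  by rewrite -[_ *: _]addr0; apply: K1_linear (K1_character _) (K1_0 _ _).
apply/esym; elim/big_ind2 : _ => [|u X' v Y' <- <-|k _]; first exact: random_integral0.
  exact: random_integralD.
exact: random_integralZ.
Qed.

Lemma symm_character (c : R[i]) (p : 'I_nu -> int) x :
  symm (fun x => c * character p x) x = (complex.Re c)%:C * character p x.
Proof.
rewrite /symm character_opp conjcM conjcK -mulrDl mulrA; congr (_ * _).
by apply: eqc_ReIm; rewrite ?ReM ?ImM ?ReD ?ImD ?ReJ ?ImJ /=; field.
Qed.

Lemma field_span_symm (t : torus R nu -> R[i]) : trig t -> field_span (I (toL2 mu (symm t))).
Proof.
elim=> [c p|f g tf IHf tg IHg].
  rewrite (_ : symm _ = fun x => (complex.Re c)%:C * character p x); last first.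
    by apply/funext => x; exact: symm_character.
  rewrite (toL2Z _ (sq_integrable_character p)) random_integralZ.
  exists 1%N, (fun=> complex.Re c), (fun=> p).
  by rewrite big_ord1.
have If := sq_integrable_symm (sq_integrable_trig (diag_measure_fin G j) tf).
have Ig := sq_integrable_symm (sq_integrable_trig (diag_measure_fin G j) tg).
rewrite (_ : symm _ = fun x => symm f x + symm g x); last first.
  by apply/funext => x; rewrite /symm conjcD -mulrDr addrACA.
by rewrite (toL2D If Ig) random_integralD; exact: field_spanD.
Qed.

(** The image of [K1] contains the span and is closed: by isometry, preimages of a convergent
    sequence are Cauchy, and [K1] is closed in a complete space. Conversely, a complex trigonometric
    polynomial close to [u] stays as close after symmetrization, when its integral lies in the
    span. *)
Lemma H1_image : H1 Z j = I @` K1 G j.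
Proof.
apply/seteqP; split => [X cX|_ [u Ku <-] B].
- have /choice[u hu] : forall n : nat, exists u, K1 G j u /\ `|X - I u| < n.+1%:R^-1.
    move=> n; have n0 : 0 < n.+1%:R^-1 :> R by rewrite invr_gt0.
    have [Y [/field_span_K1[u Ku ->]]] := cX _ (nbhsx_ballx X _ n0).
    by rewrite -ball_normE => h; exists u.
  have IuX : (fun n => I (u n)) @ \oo --> X.
    apply/cvgrPdist_lt => e e0; have [N hN] := invS_small e0.
    by exists N => // n /= /hN; exact: lt_trans (hu n).2.
  have cu : cauchy (u @ \oo).
    have /cauchy_normP cI : cauchy ((fun n => I (u n)) @ \oo).
      by apply: cvg_cauchy; apply/cvg_ex; exists X.
    apply/cauchy_normP => e /cI[N hN]; exists N => m n Nm Nn.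
    by have := hN m n Nm Nn; rewrite random_integralB random_integral_norm.
  have [l ul] := L2_complete cu.
  exists l; first exact: K1_closed (fun n => (hu n).1) ul.
  apply: le_eps_eq => e e0; have e20 : 0 < e / 2 by rewrite divr_gt0.
  move/cvgrPdist_lt : ul => /(_ _ e20)[N1 _ h1].
  move/cvgrPdist_lt : IuX => /(_ _ e20)[N2 _ h2].
  pose N := maxn N1 N2.
  rewrite -(subrK (I (u N)) (I l)) -addrA; apply: le_trans (ler_normD _ _) _.
  rewrite [e]splitr random_integralB random_integral_norm [`|_ - X|]distrC.
  apply: lerD; apply: ltW; first by apply: h1; rewrite /= leq_maxl.
  by apply: h2; rewrite /= leq_maxr.
- move=> /nbhs_ballP[e /= e0 eB].
  have [t tt ht] := trig_dense (diag_measure_fin G j) u e0.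
  exists (I (toL2 mu (symm t))); split; first exact: field_span_symm.
  apply: eB; rewrite -ball_normE /= random_integralB random_integral_norm.
  apply: le_lt_trans ht; apply: K1_symm_approx => //.
  exact: sq_integrable_trig (diag_measure_fin G j) _ tt.
Qed.

(** The clauses peculiar to [H1] are transported from [K1] along the isometry; reality of the scalar
    product uses that the full complex product is preserved. *)
Lemma H1_hilbert : real_hilbert_space (H1 Z j) (@L2dot _ _ R P).
Proof.
have [[K0 Kl] Kim [Ksym Klin] [Kpos Knorm] Kcomplete] := K1_hilbert G j.
rewrite H1_image; split.
- split; first by exists 0 => //; exact: random_integral0.
  move=> a _ _ [u Ku <-] [v Kv <-]; exists (a *: u + v); first exact: Kl.
  exact: random_integral_linear.
- by move=> _ _ [u Ku <-] [v Kv <-]; rewrite random_integral_dot Kim.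
- split=> [_ _ [u Ku <-] [v Kv <-]|a u v w _ _ _]; last exact: L2dotDl.
  by rewrite !random_integral_dot Ksym.
- split=> _ [u Ku <-]; last by rewrite L2dot_norm.
  rewrite random_integral_dot; have [p0 p1] := Kpos u Ku.
  by split=> // /p1 ->; exact: random_integral0.
- move=> X_ KX cX.
  have /choice[u hu] : forall n, exists u, K1 G j u /\ I u = X_ n.
    by move=> n; have [u Ku uX] := KX n; exists u.
  have cu : cauchy (u @ \oo).
    have /cauchy_normP cI := cX.
    apply/cauchy_normP => e /cI[N hN]; exists N => m n Nm Nn.
    have := hN m n Nm Nn; have [_ <-] := hu m; have [_ <-] := hu n.
    by rewrite random_integralB random_integral_norm.
  have [l Kl' ul] := Kcomplete u (fun n => proj1 (hu n)) cu.
  exists (I l); first by exists l.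
  apply/cvgrPdist_lt => e e0; move/cvgrPdist_lt : ul => /(_ _ e0).
  apply: filterS => n; have [_ <-] := hu n.
  by rewrite random_integralB random_integral_norm.
Qed.

End isometry_onto.

Theorem lemma3p2 (R : realType) (nu d : nat) (G : spectral_measure R nu d)
    (dO : measure_display) (Omega : measurableType dO)
    (P : probability Omega R) (Z : random_spectral_measure G P) (j : 'I_d) :
  [/\ real_hilbert_space (K1 G j) (@L2dot _ _ R (diag_measure G j)),
      real_hilbert_space (H1 Z j) (@L2dot _ _ R P),
      (forall (a : R) u v, K1 G j u -> K1 G j v ->
        random_integral Z j (a *: u + v) =
        a *: random_integral Z j u + random_integral Z j v),
      (forall u, K1 G j u -> `|random_integral Z j u| = `|u|) &
      set_bij (K1 G j) (H1 Z j) (random_integral Z j)].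
Proof.
split.
- exact: K1_hilbert.
- exact: H1_hilbert.
- by move=> a u v _ _; exact: random_integral_linear.
- by move=> u _; exact: random_integral_norm.
- rewrite H1_image; split => [u Ku|u v _ _ Iuv|//]; first by exists u.
  apply: le_eps_eq => e e0.
  by rewrite -(random_integral_norm Z) -random_integralB Iuv subrr normr0 ltW.
Qed.
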